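(* Let $(S,P)=(M_{z_1+z_2},M_{z_1z_2})$ on the Hardy space $H^2(\mathbb{D}^2)$. Then $\mathcal{D}_{P^*}$ consists of all $f=\sum_{i,j\ge0} a_{ij}z_1^iz_2^j\in H^2(\mathbb{D}^2)$ with $a_{ij}=0$ whenever $i,j\ge1$. Define $B:\mathcal{D}_{P^*}\to\mathcal{D}_{P^*}$ by $$B\begin{pmatrix} a_{00}&a_{01}&a_{02}&\dots\\ a_{10}&0&0&\dots\\ a_{20}&0&0&\dots\\ \vdots&\vdots&\vdots&\ddots\end{pmatrix}=\begin{pmatrix} a_{10}+a_{01}&a_{02}&a_{03}&\dots\\ a_{20}&0&0&\dots\\ a_{30}&0&0&\dots\\ \vdots&\vdots&\vdots&\ddots\end{pmatrix}$$ for all $a_{j0},a_{0j}\in\mathbb{C}$ with $|a_{00}|^2+\sum_{j\ge1}|a_{0j}|^2+\sum_{j\ge1}|a_{j0}|^2<\infty$. Then $B$ is the fundamental operator of $(S^*,P^* )$.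
   Context: $H^2(\mathbb{D}^2)$ is the Hilbert space of functions $f(z_1,z_2)=\sum_{i,j\ge0}a_{ij}z_1^iz_2^j$ on $\mathbb{D}^2$ with $\sum|a_{ij}|^2<\infty$ and inner product $\langle\sum a_{ij}z_1^iz_2^j,\sum b_{ij}z_1^iz_2^j\rangle=\sum a_{ij}\overline{b_{ij}}$. Such an $f$ is identified with the infinite matrix $((a_{ij}))_{i,j\ge0}$, whose $(i,j)$ entry is the coefficient of $z_1^iz_2^j$. $M_\varphi$ denotes multiplication by $\varphi$. With $\Gamma=\{(z_1+z_2,z_1z_2):|z_1|\le1,|z_2|\le1\}$, a $\Gamma$-contraction is a commuting pair $(S,P)$ of bounded Hilbert space operators with $\|f(S,P)\|\le\sup_{\Gamma}|f|$ for all polynomials $f$ in two variables; the pair $(S,P)$ here, and its adjoint pair $(S^*,P^* )$, are $\Gamma$-contractions. For a contraction $P$, $D_{P^*}=(I-PP^* )^{1/2}$ and $\mathcal{D}_{P^*}=\overline{\mathrm{Ran}}\,D_{P^*}$. The fundamental operator of the $\Gamma$-contraction $(S^*,P^* )$ is the unique $X\in\mathcal{B}(\mathcal{D}_{P^*})$ with $S^*-SP^*=D_{P^*}XD_{P^*}$. *)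

(* Defs.v *)
From HB Require Import structures.
From mathcomp Require Import all_boot all_order all_algebra.
From mathcomp Require Import complex ring lra zify.
From mathcomp Require Import all_classical all_reals all_analysis.

Set Implicit Arguments.
Unset Strict Implicit.
Unset Printing Implicit Defensive.

Import Order.TTheory GRing.Theory Num.Theory.
Import numFieldNormedType.Exports.

Local Open Scope classical_set_scope.
Local Open Scope ring_scope.

HB.mixin Record CompleteNormedModule_isHilbert (R : realType) V
    & CompleteNormedModule R[i] V := {
  inner : {dot V for Num.conj};
  normE_inner : forall x : V, `|x| ^+ 2 = inner x x
}.

#[short(type="hilbertType")]
HB.structure Definition Hilbert (R : realType) :=
  {V of CompleteNormedModule R[i] V & CompleteNormedModule_isHilbert R V}.

Section HilbertOperators.
Variables (R : realType) (V : hilbertType R).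
Local Notation C := R[i].
Implicit Types (S P T D X : V -> V) (A : set V).

(* B(A) for a linear subspace A: such X is a total function of which only the
   restriction to A matters. *)
Definition bounded_op_on A X :=
  [/\ forall x, A x -> A (X x),
      forall (a : C) x y, A x -> A y -> X (a *: x + y) = a *: X x + X y
    & exists M : R, forall x, A x -> `|X x| <= M%:C%C * `|x|].

Definition bounded_op T := bounded_op_on [set: V] T.

Definition is_adjoint T T' :=
  bounded_op T' /\ forall x y, inner (T x) y = inner x (T' y).

Definition adjoint T : V -> V := xget (fun=> 0) [set T' | is_adjoint T T'].

Definition positive_op T := bounded_op T /\ forall x, 0 <= inner (T x) x.

Definition sqrt_op T : V -> V :=
  xget (fun=> 0) [set D | positive_op D /\ forall x, D (D x) = T x].

Definition op_norm T : \bar R :=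
  ereal_sup [set (complex.Re `|T x|)%:E | x in [set x : V | `|x| <= 1]].

Definition Gamma : set (C * C) :=
  [set (z.1 + z.2, z.1 * z.2) | z in [set z : C * C | `|z.1| <= 1 /\ `|z.2| <= 1]].

(* A polynomial f(s, p) is an element of {poly {poly C}}, the inner variable
   being s and the outer one p: the coefficient of s^j p^i is f`_i`_j. *)
Definition poly2_eval (f : {poly {poly C}}) (s p : C) : C := f.[p%:P].[s].

Definition poly2_op (f : {poly {poly C}}) S P : V -> V :=
  fun x => \sum_(i < size f) \sum_(j < size f`_i)
    f`_i`_j *: iter j S (iter i P x).

Definition gamma_contraction S P :=
  [/\ bounded_op S, bounded_op P, forall x, S (P x) = P (S x)
    & forall f : {poly {poly C}},
        (op_norm (poly2_op f S P) <=
         ereal_sup [set (complex.Re `|poly2_eval f z.1 z.2|)%:E | z in Gamma])%E].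

Definition defect_op P : V -> V := sqrt_op (fun x => x - adjoint P (P x)).

Definition defect_space P : set V := closure (range (defect_op P)).

Definition fundamental_equation S P X :=
  forall x, S x - adjoint S (P x) = defect_op P (X (defect_op P x)).

Definition is_fundamental_operator S P X :=
  [/\ gamma_contraction S P,
      bounded_op_on (defect_space P) X,
      fundamental_equation S P X
    & forall Y, bounded_op_on (defect_space P) Y -> fundamental_equation S P Y ->
        forall x, defect_space P x -> Y x = X x].

End HilbertOperators.

Section SquareSummable.
Variable R : realType.
Local Notation C := R[i].

Definition square_summable (a : nat -> nat -> C^o) : Prop :=
  (\esum_(k in [set: nat * nat]) ((Normc.normc (a k.1 k.2)) ^+ 2)%:E < +oo)%E.

Definition hardy_pred : {pred nat -> nat -> C^o} :=
  fun a => `[< square_summable a >].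

Definition sqpart (u : nat -> nat -> R) n := \sum_(i < n) \sum_(j < n) u i j.

Definition bounded_sum (u : nat -> nat -> R) := exists M, forall n, sqpart u n <= M.

Lemma sqpart_le (u : nat -> nat -> R) m n :
  (forall i j, 0 <= u i j) -> (m <= n)%N -> sqpart u m <= sqpart u n.
Proof.
move=> u0 mn; rewrite /sqpart.
have le1 (v : nat -> R) : (forall i, 0 <= v i) -> \sum_(i < m) v i <= \sum_(i < n) v i.
  move=> v0; rewrite -2!(big_mkord xpredT v) (@big_cat_nat _ _ _ m 0%N n)//=.
  by rewrite lerDl sumr_ge0.
apply: le_trans (le1 (fun i => \sum_(j < n) u i j) _).
  by apply: ler_sum => i _; exact: le1.
by move=> i; apply: sumr_ge0.
Qed.

Let box n : set (nat * nat) := [set k | (k.1 < n)%N /\ (k.2 < n)%N].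

Let boxs n := allpairs pair (iota 0 n) (iota 0 n).

Let boxE n : box n = [set` boxs n].
Proof.
apply/seteqP; split=> -[i j] /=.
  by move=> [ilt jlt]; rewrite /boxs allpairs_f// mem_iota.
by move=> /allpairsP[[x y] /= [+ + [-> ->]]]; rewrite !mem_iota.
Qed.

Let finite_box n : finite_set (box n).
Proof. by rewrite boxE; exact: finite_seq. Qed.

Let sqpartE (u : nat -> nat -> R) n :
  (sqpart u n)%:E = (\sum_(k \in box n) (u k.1 k.2)%:E)%E.
Proof.
rewrite boxE -fsbig_seq; last first.
  by apply: allpairs_uniq; rewrite ?iota_uniq// => -[? ?] [? ?].
rewrite sumEFin; congr EFin; rewrite /boxs big_allpairs /sqpart.
have e (v : nat -> R) : \sum_(i < n) v i = \sum_(i <- iota 0 n) v i.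
  by rewrite -(big_mkord xpredT v) /index_iota subn0.
by rewrite (e (fun i => \sum_(j < n) u i j)); apply: eq_bigr => i _; exact: e.
Qed.

Lemma esum_bounded_sumP (u : nat -> nat -> R) : (forall i j, 0 <= u i j) ->
  (\esum_(k in [set: nat * nat]) (u k.1 k.2)%:E < +oo)%E <->
  exists M, forall n, sqpart u n <= M.
Proof.
move=> u0; split.
  move=> uoo; exists (fine (\esum_(k in [set: nat * nat]) (u k.1 k.2)%:E)%E) => n.
  rewrite -lee_fin fineK; last first.
    by rewrite ge0_fin_numE// esum_ge0// => k _; rewrite lee_fin.
  by rewrite sqpartE; apply: ereal_sup_ubound; exists (box n).
move=> [M uM]; apply: le_lt_trans (ltry M).
apply: ge_ereal_sup => _ [A [fA _] <-].
case/finite_seqP: (fA) => s As.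
pose N := (\sum_(k <- s) (k.1 + k.2).+1)%N.
apply: (@le_trans _ _ (sqpart u N)%:E); last by rewrite lee_fin.
rewrite sqpartE; apply: lee_fsum_nneg_subset => //; last first.
  by move=> k _; rewrite lee_fin.
move=> k; rewrite As !inE /= => ks.
have kN : ((k.1 + k.2).+1 <= N)%N.
  rewrite /N (perm_big _ (perm_to_rem ks)) big_cons; exact: leq_addr.
by split; apply: leq_trans kN; rewrite ltnS (leq_addr, leq_addl).
Qed.

Lemma cvg_sqpart (u : nat -> nat -> R) :
  bounded_sum (fun i j => `|u i j|) -> cvgn (sqpart u).
Proof.
have bnd (v : nat -> nat -> R) M : (forall i j, 0 <= v i j) ->
    (forall n, sqpart v n <= M) -> cvgn (sqpart v).
  move=> v0 vM; apply: nondecreasing_is_cvgn.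
    by move=> m n mn; exact: sqpart_le.
  by exists M => _ [n _ <-].
move=> [M uM].
have -> : sqpart u =
    sqpart (fun i j => u i j + `|u i j|) \- sqpart (fun i j => `|u i j|).
  apply/funext => n /=; rewrite /sqpart -sumrB; apply: eq_bigr => i _.
  by rewrite -sumrB; apply: eq_bigr => j _; rewrite addrK.
apply: is_cvgB; last exact: bnd uM.
apply: (bnd _ (M *+ 2)).
  by move=> i j; rewrite -lerBlDr sub0r lerNl -normrN ler_norm.
move=> n; apply: (@le_trans _ _ (sqpart (fun i j => `|u i j|) n *+ 2)).
  rewrite /sqpart -sumrMnl; apply: ler_sum => i _.
  by rewrite -sumrMnl; apply: ler_sum => j _; rewrite mulr2n lerD2r ler_norm.
by rewrite lerMn2r uM orbT.
Qed.

Definition nsq (z : C) : R := complex.Re z ^+ 2 + complex.Im z ^+ 2.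

Lemma nsqE z : Normc.normc z ^+ 2 = nsq z.
Proof. by case: z => a b /=; rewrite sqr_sqrtr// addr_ge0// sqr_ge0. Qed.

Lemma nsq_ge0 z : 0 <= nsq z. Proof. by rewrite addr_ge0// sqr_ge0. Qed.

Lemma square_summableE a :
  square_summable a <-> bounded_sum (fun i j => nsq (a i j)).
Proof.
apply: iff_trans (esum_bounded_sumP (fun i j => nsq_ge0 (a i j))).
by rewrite /square_summable; under [X in (X < _)%E <-> _]eq_esum do rewrite nsqE.
Qed.

Lemma le_bounded_sum (u v : nat -> nat -> R) : (forall i j, u i j <= v i j) ->
  bounded_sum v -> bounded_sum u.
Proof.
move=> uv [M vM]; exists M => n; apply: le_trans (vM n).
by apply: ler_sum => i _; apply: ler_sum.
Qed.

Lemma bounded_sumD (c d : R) (u v : nat -> nat -> R) : 0 <= c -> 0 <= d ->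
  bounded_sum u -> bounded_sum v ->
  bounded_sum (fun i j => c * u i j + d * v i j).
Proof.
move=> c0 d0 [M uM] [N vN]; exists (c * M + d * N) => n.
have -> : sqpart (fun i j => c * u i j + d * v i j) n =
   c * sqpart u n + d * sqpart v n.
  rewrite /sqpart !mulr_sumr -big_split/=; apply: eq_bigr => i _.
  by rewrite !mulr_sumr -big_split.
by apply: lerD; apply: ler_wpM2l.
Qed.

Lemma hardy_submod_closed : submod_closed hardy_pred.
Proof.
split.
  rewrite unfold_in; apply/asboolP/square_summableE; exists 0 => n.
  by rewrite /sqpart big1// => i _; rewrite big1// => j _; rewrite /nsq/= expr0n addr0.
move=> c f g; rewrite !unfold_in => /asboolP/square_summableE Bf.
move=> /asboolP/square_summableE Bg; apply/asboolP/square_summableE.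
have c0 : 0 <= 2 * nsq c by rewrite mulr_ge0// nsq_ge0.
apply: le_bounded_sum (bounded_sumD c0 (ler0n R 2) Bf Bg) => i j.
change ((c *: f + g) i j) with (c * (f i j : C) + (g i j : C)).
rewrite /nsq; case: c {c0} (f i j) (g i j) => [a b] [x y] [z w] /=.
have := sqr_ge0 (a * x - b * y - z); have := sqr_ge0 (a * y + b * x - w).
simpc => /=; nra.
Qed.

HB.instance Definition _ :=
  GRing.isSubmodClosed.Build _ _ hardy_pred hardy_submod_closed.

(* The sum of an absolutely summable double series, computed on the real and
   imaginary parts as the limit of the square partial sums. *)
Definition csum (u : nat -> nat -> C) : C :=
  Complex (limn (sqpart (fun i j => complex.Re (u i j))))
          (limn (sqpart (fun i j => complex.Im (u i j)))).

Definition abs_summable (u : nat -> nat -> C) :=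
  bounded_sum (fun i j => Normc.normc (u i j)).

Lemma normRe (z : C) : `|complex.Re z| <= Normc.normc z.
Proof.
by case: z => a b /=; rewrite -sqrtr_sqr ler_wsqrtr// lerDl sqr_ge0.
Qed.

Lemma normIm (z : C) : `|complex.Im z| <= Normc.normc z.
Proof.
by case: z => a b /=; rewrite -sqrtr_sqr ler_wsqrtr// lerDr sqr_ge0.
Qed.

Lemma abs_summable_Re u : abs_summable u ->
  cvgn (sqpart (fun i j => complex.Re (u i j))).
Proof. by move=> Bu; apply: cvg_sqpart; apply: le_bounded_sum Bu => i j; exact: normRe. Qed.

Lemma abs_summable_Im u : abs_summable u ->
  cvgn (sqpart (fun i j => complex.Im (u i j))).
Proof. by move=> Bu; apply: cvg_sqpart; apply: le_bounded_sum Bu => i j; exact: normIm. Qed.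

Lemma sqpart_lin (c d : R) u v n :
  sqpart (fun i j => c * u i j + d * v i j) n = c * sqpart u n + d * sqpart v n.
Proof.
rewrite /sqpart !mulr_sumr -big_split/=; apply: eq_bigr => i _.
by rewrite !mulr_sumr -big_split.
Qed.

Lemma csum_lin c u v : abs_summable u -> abs_summable v ->
  csum (fun i j => c * u i j + v i j) = c * csum u + csum v.
Proof.
move=> Bu Bv; have Ru := abs_summable_Re Bu; have Iu := abs_summable_Im Bu.
have Rv := abs_summable_Re Bv; have Iv := abs_summable_Im Bv.
case: c => a b; rewrite /csum; simpc; congr Complex; apply: cvg_lim => //.
  have -> : sqpart (fun i j => complex.Re (Complex a b * u i j + v i j)) =
    (fun n => (a * sqpart (fun i j => complex.Re (u i j)) n
     - b * sqpart (fun i j => complex.Im (u i j)) n)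
     + sqpart (fun i j => complex.Re (v i j)) n).
    apply/funext => n; rewrite -mulNr -sqpart_lin -[X in X + _]mul1r.
    rewrite -[X in _ + X]mul1r -sqpart_lin; congr sqpart.
    apply/funext => i; apply/funext => j; case: (u i j) (v i j) => x y [z w] /=.
    by rewrite !mul1r mulNr.
  by apply: cvgD => //; apply: cvgB; apply: cvgMr.
have -> : sqpart (fun i j => complex.Im (Complex a b * u i j + v i j)) =
    (fun n => (a * sqpart (fun i j => complex.Im (u i j)) n
     + b * sqpart (fun i j => complex.Re (u i j)) n)
     + sqpart (fun i j => complex.Im (v i j)) n).
  apply/funext => n; rewrite -sqpart_lin -[X in X + _]mul1r.
  rewrite -[X in _ + X]mul1r -sqpart_lin; congr sqpart.
  apply/funext => i; apply/funext => j; case: (u i j) (v i j) => x y [z w] /=.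
  by rewrite !mul1r.
by apply: cvgD => //; apply: cvgD; apply: cvgMr.
Qed.

Lemma csum_conj u : abs_summable u ->
  csum (fun i j => Num.conj (u i j)) = Num.conj (csum u).
Proof.
move=> Bu; rewrite /csum; congr Complex.
  by congr (limn (sqpart _)); apply/funext => i; apply/funext => j; case: (u i j).
rewrite -limN; last exact: abs_summable_Im.
congr (lim (_ @ \oo)); apply/funext => n; rewrite /sqpart.
rewrite [RHS](_ : _ = - \sum_(i < n) \sum_(j < n) complex.Im (u i j))//.
rewrite -sumrN; apply: eq_bigr => i _.
by rewrite -sumrN; apply: eq_bigr => j _; case: (u i j).
Qed.

Lemma bounded_sumM (a b : nat -> nat -> C) : square_summable a ->
  square_summable b -> abs_summable (fun i j => a i j * Num.conj (b i j)).
Proof.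
move=> /square_summableE Ba /square_summableE Bb.
apply: le_bounded_sum (bounded_sumD ler01 ler01 Ba Bb) => i j.
rewrite !mul1r Normc.normcM -!nsqE.
have -> : Normc.normc (Num.conj (b i j)) = Normc.normc (b i j).
  by case: (b i j) => x y /=; rewrite sqrrN.
have := sqr_ge0 (Normc.normc (a i j) - Normc.normc (b i j)).
have x0 (z : C) : 0 <= Normc.normc z by case: z => x y; exact: sqrtr_ge0.
have := x0 (a i j); have := x0 (b i j); nra.
Qed.

End SquareSummable.

Section DotTriangle.
Variables (K : numClosedFieldType) (U : lmodType K) (form : {dot U for Num.conj}).
Local Notation "''[' u , v ]" := (form u%R v%R) : ring_scope.
Local Notation "''[' u ]" := '[u, u]%R : ring_scope.

Lemma dot_CauchySchwarz (u v : U) : `|'[u, v]| ^+ 2 <= '[u] * '[v].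
Proof.
have [->|nz_v] := eqVneq v 0.
  by rewrite linear0r normr0 expr0n mulr_ge0 ?dnorm_ge0.
pose a := '[u, v] / '[v]; pose u1 := u - a *: v.
have va : a * '[v] = '[u, v] by rewrite /a divfK ?dnorm_eq0.
have ou : '[u1, v] = 0 by rewrite linearBl/= linearZl_LR/= va subrr.
have -> : '[u] = '[u1] + `|a| ^+ 2 * '[v].
  rewrite -dnormZ -hnormDd/= ?subrK// linearZr_LR/= ou mulr0//.
rewrite mulrDl -va normrM exprMn (ger0_norm (dnorm_ge0 _ v)) expr2 mulrA.
by rewrite lerDr mulr_ge0// dnorm_ge0.
Qed.

Lemma dot_triangle (u v : U) : sqrtC '[u + v] <= sqrtC '[u] + sqrtC '[v].
Proof.
rewrite -ler_sqr ?nnegrE ?addr_ge0 ?sqrtC_ge0 ?dnorm_ge0//.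
rewrite sqrrD !sqrtCK dnormD/= [leRHS]addrAC lerD2l.
rewrite -[leLHS](divfK (negbT (pnatr_eq0 K 2))) -/('Re _) -ReE.
rewrite -[leRHS]mulr_natr ler_pM2r ?ltr0n//.
rewrite (le_trans (leif_Re_Creal _))// -ler_sqr ?nnegrE ?mulr_ge0//.
- by rewrite exprMn !sqrtCK dot_CauchySchwarz.
- by rewrite sqrtC_ge0 dnorm_ge0.
- by rewrite sqrtC_ge0 dnorm_ge0.
Qed.

End DotTriangle.

Section HardySpace.
Variable R : realType.
Local Notation C := R[i].

(* A function of the Hardy space of the bidisc is identified with the matrix of
   its coefficients: coef f i j is the coefficient of z1^i z2^j. *)
Record hardy : Type := Hardy {
  coef :> nat -> nat -> C^o ;
  coefP : coef \in @hardy_pred R }.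

HB.instance Definition _ := [isSub for coef].
HB.instance Definition _ := [Choice of hardy by <:].
HB.instance Definition _ := [SubChoice_isSubLmodule of hardy by <:].

Lemma coef_inj (f g : hardy) : (forall i j, f i j = g i j) -> f = g.
Proof.
by move=> fg; apply: val_inj; apply/funext => i; apply/funext => j; exact: fg.
Qed.

Lemma coef_sq (f : hardy) : square_summable f.
Proof. by have := coefP f; rewrite unfold_in => /asboolP. Qed.

Definition hardy_inner (f g : hardy) : C :=
  csum (fun i j => f i j * Num.conj (g i j : C)).

Lemma hardy_innerP f g c h :
  hardy_inner (c *: f + g) h = c * hardy_inner f h + hardy_inner g h.
Proof.
rewrite /hardy_inner -csum_lin; [|exact: bounded_sumM (coef_sq _) (coef_sq _)..].
congr csum; apply/funext => i; apply/funext => j.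
change ((c *: f + g) i j) with (c * (f i j : C) + (g i j : C)).
by rewrite mulrDl mulrA.
Qed.

Lemma hardy_inner_conj f g : hardy_inner f g = Num.conj (hardy_inner g f).
Proof.
rewrite /hardy_inner -csum_conj; last exact: bounded_sumM (coef_sq _) (coef_sq _).
congr csum; apply/funext => i; apply/funext => j.
by rewrite [RHS]rmorphM /= conjCK mulrC.
Qed.

Lemma hardy_bilinear : bilinear_for *%R (Num.conj \; *%R) hardy_inner.
Proof.
split=> [h c f g|h c f g] /=; first exact: hardy_innerP.
rewrite hardy_inner_conj hardy_innerP rmorphD rmorphM.
by rewrite [in RHS]hardy_inner_conj [X in _ = _ + X]hardy_inner_conj.
Qed.

HB.instance Definition _ := @bilinear_isBilinear.Build C hardy hardy C
  *%R (Num.conj \; *%R) hardy_inner hardy_bilinear.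

Lemma hardy_hermitian f g :
  hardy_inner f g = (-1) ^+ false * Num.conj (hardy_inner g f).
Proof. by rewrite expr0 mul1r; exact: hardy_inner_conj. Qed.

HB.instance Definition _ := @isHermitianSesquilinear.Build C hardy false Num.conj
  hardy_inner hardy_hermitian.

Lemma hardy_sq_cvg (f : hardy) : cvgn (sqpart (fun i j => nsq (f i j))).
Proof.
apply: cvg_sqpart.
under [X in bounded_sum X]eq_fun => i do under eq_fun => j do
  rewrite ger0_norm ?nsq_ge0//.
exact/square_summableE/coef_sq.
Qed.

Lemma hardy_innerE f :
  hardy_inner f f = Complex (limn (sqpart (fun i j => nsq (f i j)))) 0.
Proof.
rewrite /hardy_inner /csum; congr Complex.
  congr (lim (sqpart _ @ \oo)); apply/funext => i; apply/funext => j.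
  by rewrite /nsq; case: (f i j : C) => x y /=; ring.
rewrite (_ : sqpart _ = fun=> 0) ?lim_cst//; apply/funext => n.
rewrite /sqpart big1// => i _; rewrite big1// => j _.
by case: (f i j : C) => x y /=; ring.
Qed.

Lemma sqpart_le_lim (f : hardy) n :
  sqpart (fun i j => nsq (f i j)) n <= limn (sqpart (fun i j => nsq (f i j))).
Proof.
apply: nondecreasing_cvgn_le; last exact: hardy_sq_cvg.
by move=> m k mk; apply: sqpart_le => // i j; exact: nsq_ge0.
Qed.

Lemma nsq_le_lim (f : hardy) i j :
  nsq (f i j) <= limn (sqpart (fun i j => nsq (f i j))).
Proof.
have [iN jN] : (i < (i + j).+1 /\ j < (i + j).+1)%N by lia.
apply: le_trans (sqpart_le_lim f (i + j).+1); rewrite /sqpart.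
rewrite (bigD1 (Ordinal iN))//= (bigD1 (Ordinal jN))//= -addrA lerDl.
by rewrite addr_ge0// sumr_ge0// => k _; rewrite ?sumr_ge0// => *; exact: nsq_ge0.
Qed.

Lemma hardy_inner_gt0 (f : hardy) : f != 0 -> 0 < hardy_inner f f.
Proof.
move=> f0; have [i [j fij]] : exists i j, f i j != 0.
  apply: contrapT => nf; move/eqP: f0; apply; apply: coef_inj => i j.
  by apply: contrapT => fij; apply: nf; exists i, j; exact/eqP.
rewrite hardy_innerE ltcR; apply: lt_le_trans (nsq_le_lim f i j).
rewrite -nsqE exprn_gt0// lt_def; apply/andP; split.
  by apply: contra fij => /eqP/Normc.eq0_normc ->.
by case: (f i j : C) => x y; exact: sqrtr_ge0.
Qed.

HB.instance Definition _ := @isDotProduct.Build C hardy hardy_inner hardy_inner_gt0.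

Definition hardy_norm (f : hardy) : C := sqrtC (hardy_inner f f).

Lemma hardy_normD f g : hardy_norm (f + g) <= hardy_norm f + hardy_norm g.
Proof. exact: dot_triangle. Qed.

Lemma hardy_normZ (c : C) f : hardy_norm (c *: f) = `|c| * hardy_norm f.
Proof.
by rewrite /hardy_norm dnormZ sqrtCM ?qualifE/= ?exprn_ge0 ?dnorm_ge0// sqrCK.
Qed.

Lemma hardy_norm0_eq0 f : hardy_norm f = 0 -> f = 0.
Proof. by move=> /eqP; rewrite sqrtC_eq0 dnorm_eq0 => /eqP. Qed.

HB.instance Definition _ := @Lmodule_isNormed.Build C hardy hardy_norm
  hardy_normD hardy_normZ hardy_norm0_eq0.

Lemma hardy_normE f : `|f| ^+ 2 = hardy_inner f f.
Proof. exact: sqrtCK. Qed.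

End HardySpace.

Section HardyComplete.
Variable R : realType.
Local Notation C := R[i].
Local Notation hardy := (hardy R).
Implicit Types f g h : hardy.

Lemma hardy_norm_le f (e : R) : 0 <= e ->
  `|f| <= e%:C%C <-> forall n, sqpart (fun i j => nsq (f i j)) n <= e ^+ 2.
Proof.
move=> e0; have ec0 : 0 <= e%:C%C by rewrite ler0c.
rewrite -ler_sqr ?nnegrE// hardy_normE hardy_innerE -rmorphXn lecR.
split=> [le n|le]; first exact: le_trans (sqpart_le_lim f n) le.
by apply: limr_le; [exact: hardy_sq_cvg|exact: nearW].
Qed.

Lemma hardy_complete (F : set_system hardy) :
  ProperFilter F -> cauchy F -> cvg F.
Proof.
move=> FF /cauchy_ballP cF.
have cF2 (e : R) : 0 < e -> \forall h & g \near F,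
    forall n, sqpart (fun i j => nsq ((h - g : hardy) i j)) n <= e ^+ 2.
  move=> e0; have /cF : 0 < e%:C%C by rewrite ltcR.
  rewrite !near2E => cFe; near=> hg; apply/hardy_norm_le; first exact: ltW.
  by apply/ltW; near: hg.
have cvF (p : C -> R) i j : (forall z w : C, p (z - w) = p z - p w) ->
    (forall z : C, p z ^+ 2 <= nsq z) -> cvg ((fun h => p (h i j)) @ F).
  move=> pB pn; apply: cauchy_cvg; apply/cauchy_ballP => e e0.
  rewrite near_map2.
  have e20 : 0 < e / 2 by rewrite divr_gt0.
  have := cF2 _ e20; rewrite !near2E => cFe; near=> hg.
  rewrite /ball/= /ball_/= -pB.
  have [iN jN] : (i < (i + j).+1 /\ j < (i + j).+1)%N by lia.
  apply: (@le_lt_trans _ _ (e / 2)); last by rewrite gtr_pMr// invf_lt1// ltr1n.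
  rewrite -ler_sqr ?nnegrE ?(ltW e20)// real_normK ?num_real//.
  apply: le_trans (pn _) _.
  have : forall n, sqpart (fun i j => nsq ((hg.1 - hg.2 : hardy) i j)) n <= (e / 2) ^+ 2.
    by near: hg.
  move=> /(_ (i + j).+1); apply: le_trans; rewrite /sqpart.
  rewrite (bigD1 (Ordinal iN))//= (bigD1 (Ordinal jN))//= -addrA lerDl.
  by rewrite addr_ge0// sumr_ge0// => k _; rewrite ?sumr_ge0// => *; exact: nsq_ge0.
have cvRe i j : cvg ((fun h => complex.Re (h i j : C)) @ F).
  apply: (cvF (@complex.Re R)); first by move=> [? ?] [? ?].
  by move=> [? ?]; rewrite /nsq/= lerDl sqr_ge0.
have cvIm i j : cvg ((fun h => complex.Im (h i j : C)) @ F).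
  apply: (cvF (@complex.Im R)); first by move=> [? ?] [? ?].
  by move=> [? ?]; rewrite /nsq/= lerDr sqr_ge0.
pose a i j : C := Complex (lim ((fun h => complex.Re (h i j : C)) @ F))
                          (lim ((fun h => complex.Im (h i j : C)) @ F)).
have key (e : R) : 0 < e -> \forall h \near F,
    forall n, sqpart (fun i j => nsq (((h : hardy) i j : C) - a i j)) n <= e ^+ 2.
  assert (FFl : Filter F) by typeclasses eauto.
  move=> e0; have H := @nearP_dep _ _ F F FFl FFl _ (cF2 _ e0); refine (@filterS hardy F _ _ _ _ H) => h hF n.
  have cv : (fun g : hardy => sqpart (fun i j => nsq ((h - g : hardy) i j)) n) @ F -->
      sqpart (fun i j => nsq ((h i j : C) - a i j)) n.
    apply: cvg_big => [|i _]; first exact: add_continuous.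
    apply: cvg_big => [|j _]; first exact: add_continuous.
    have nsqB (z w : C) : nsq (z - w) = (complex.Re z - complex.Re w) *
      (complex.Re z - complex.Re w) + (complex.Im z - complex.Im w) *
      (complex.Im z - complex.Im w).
      by case: z w => x y [z w]; rewrite /nsq/= !expr2.
    rewrite nsqB.
    rewrite (_ : (fun g => _) = fun g => (complex.Re (h i j : C) - complex.Re (g i j : C)) *
      (complex.Re (h i j : C) - complex.Re (g i j : C)) + (complex.Im (h i j : C) - complex.Im (g i j : C)) *
      (complex.Im (h i j : C) - complex.Im (g i j : C))); last first.
      by apply/funext => g; rewrite -nsqB.
    by apply: cvgD; apply: cvgM; apply: cvgB; [exact: cvg_cst|exact: cvRe|
      exact: cvg_cst|exact: cvRe|exact: cvg_cst|exact: cvIm|exact: cvg_cst|exact: cvIm].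
  rewrite -(cvg_lim _ cv)//; apply: limr_le; first by apply: cvgP cv.
  by near=> g; move: n {cv}; near: g.
have [h0 h0P] := filter_ex (key 1 ltr01).
have dP : (fun i j => (h0 i j : C) - a i j : C^o) \in @hardy_pred R.
  by rewrite unfold_in; apply/asboolP/square_summableE; exists (1 ^+ 2).
pose A := h0 - Hardy dP.
have AE i j : A i j = a i j.
  by change ((h0 i j : C) - ((h0 i j : C) - a i j) = a i j); rewrite subKr.
apply/cvg_ex; exists A; apply/cvgrPdist_le => e e0.
have eE : e = (complex.Re e)%:C%C by rewrite RRe_real// gtr0_real.
have Re0 : 0 < complex.Re e by rewrite -ltcR -eE.
near=> h; rewrite distrC eE; apply/hardy_norm_le; first exact: ltW.
move=> n; have : forall n, sqpart (fun i j => nsq ((h i j : C) - a i j)) n <= complex.Re e ^+ 2.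
  by near: h; exact: key.
move=> /(_ n); congr (sqpart _ n <= _); apply/funext => i; apply/funext => j.
by rewrite -AE.
Unshelve. all: by end_near. Qed.

HB.instance Definition _ := Uniform_isComplete.Build hardy hardy_complete.

HB.instance Definition _ := @CompleteNormedModule_isHilbert.Build R hardy
  (@hardy_inner R) (@hardy_normE R).

End HardyComplete.

Section HardyOperators.
Variable R : realType.
Local Notation C := R[i].
Implicit Types f g : hardy R.

(* The value at (z1, z2) in the bidisc, where the series converges absolutely. *)
Definition hardy_eval f (z1 z2 : C) : C :=
  csum (fun i j => (f i j : C) * z1 ^+ i * z2 ^+ j).

Definition mult_op (phi : C -> C -> C) : hardy R -> hardy R := fun f =>
  xget 0 [set g : hardy R | forall z1 z2, `|z1| < 1 -> `|z2| < 1 ->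
    hardy_eval g z1 z2 = phi z1 z2 * hardy_eval f z1 z2].

(* The first row and column of the matrix a are shifted towards the corner. *)
Definition B_coef (a : nat -> nat -> C^o) (i j : nat) : C^o :=
  match i, j with
  | 0%N, 0%N => a 1%N 0%N + a 0%N 1%N
  | 0%N, _.+1 => a 0%N j.+1
  | _.+1, 0%N => a i.+1 0%N
  | _.+1, _.+1 => 0
  end.

Lemma bounded_sum_shiftl (u : nat -> nat -> R) : (forall i j, 0 <= u i j) ->
  bounded_sum u -> bounded_sum (fun i j => u i.+1 j).
Proof.
move=> u0 [M uM]; exists M => n; apply: le_trans (uM n.+1).
rewrite /sqpart [leRHS]big_ord_recl/= -[leLHS]add0r lerD ?sumr_ge0//.
by apply: ler_sum => i _; rewrite [leRHS]big_ord_recr/= lerDl.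
Qed.

Lemma bounded_sum_shiftr (u : nat -> nat -> R) : (forall i j, 0 <= u i j) ->
  bounded_sum u -> bounded_sum (fun i j => u i j.+1).
Proof.
move=> u0 [M uM]; exists M => n; apply: le_trans (uM n.+1).
rewrite /sqpart [leRHS]big_ord_recr/= -[leLHS]addr0 lerD ?sumr_ge0//.
by apply: ler_sum => i _; rewrite [leRHS]big_ord_recl/= lerDr.
Qed.

Lemma B_coefP f : B_coef f \in @hardy_pred R.
Proof.
rewrite unfold_in; apply/asboolP/square_summableE.
have /square_summableE Bf := coef_sq f.
have n0 i j : 0 <= nsq (f i j) by exact: nsq_ge0.
apply: le_bounded_sum (bounded_sumD (ler0n R 2) (ler0n R 2)
  (bounded_sum_shiftl n0 Bf) (bounded_sum_shiftr n0 Bf)).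
have le2 (x y : R) : 0 <= x -> 0 <= y -> (x <= 2 * x + 2 * y) /\ (y <= 2 * x + 2 * y).
  by move=> ? ?; split; lra.
move=> [|i] [|j] /=.
- case: (f 1%N 0%N) (f 0%N 1%N) => [a b] [c d]; rewrite /nsq.
  change ((a + c) ^+ 2 + (b + d) ^+ 2 <=
    2 * (a ^+ 2 + b ^+ 2) + 2 * (c ^+ 2 + d ^+ 2)).
  have := sqr_ge0 (a - c); have := sqr_ge0 (b - d); nra.
- by have [] := le2 _ _ (n0 1%N j.+1) (n0 0%N j.+2).
- by have [] := le2 _ _ (n0 i.+2 0%N) (n0 i.+1 1%N).
- by rewrite /nsq/= expr0n addr0 addr_ge0// mulr_ge0// nsq_ge0.
Qed.

Definition B_op f : hardy R := Hardy (B_coefP f).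

End HardyOperators.

(* Main.v *)
Require Import Defs.
From mathcomp Require Import all_boot all_order all_algebra.
From mathcomp Require Import complex.
From mathcomp Require Import cyclic separable cyclotomic.
From mathcomp Require Import all_classical all_reals all_analysis.
From mathcomp Require Import lra zify.
Set Implicit Arguments.
Unset Strict Implicit.
Unset Printing Implicit Defensive.
Import Order.TTheory GRing.Theory Num.Theory.
Import numFieldNormedType.Exports.
Local Open Scope classical_set_scope.
Local Open Scope ring_scope.

(** Evaluation at a point (z, w) of the bidisc is the inner product with the
    Szego kernel k_(z,w), whose coefficients are conj(z)^i conj(w)^j, and k_(z,w)
    is an eigenvector of the two backward shifts of coefficient matrices.  Since
    the backward shifts are the adjoints of the forward ones, the forward shifts
    act on values as multiplication by z and by w.  A member of the Hardy space
    is determined by its values ([vanishes_eq0]), so S and P are the sum and the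
    product of the forward shifts ([mult_op_add], [mult_op_mul]), and their
    adjoints S' and P' are the sum [sum_bwd] and the product [prod_bwd] of the
    backward shifts.

    P is an isometry, so the square of the defect operator of P' is I - P P',
    the projection that erases the entries with both indices positive ([axes_proj]).
    A projection is its own unique positive square root
    ([sqrt_op_projection]), hence the defect operator is [axes_proj] and the defect
    space is its range, which is closed.  With this, the fundamental equation
    S' - S P' = D B D is a comparison of coefficients ([fundamental_eq_coef]), and
    it determines B on the range of D because D is the identity there.

    What remains is that (S', P') is a Gamma-contraction, which is von Neumann's
    inequality for the pair of backward shifts ([norm_poly2_op]).  A finite block
    of the matrix of p(S', P') f depends on a finite block of the matrix of f only,
    so that f may be replaced by an N-periodic matrix with N large.  On N-periodic
    matrices the shifts are diagonalised by the discrete Fourier transform on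
    (Z/N)^2, their eigenvalues are N-th roots of unity s, t, and there p(S', P')
    is multiplication by p(s + t, s t), a value of p on Gamma.  Parseval's identity
    ([parseval2]) then gives the bound. *)

(** * Operators on a Hilbert space *)

Section HilbertGeneral.
Variables (R : realType) (V : hilbertType R).
Implicit Types (T U D Q : V -> V) (x y : V).

Lemma inner_norm x : inner x x = `|x| ^+ 2.
Proof. by rewrite normE_inner. Qed.

Lemma inner_eq0 x : inner x x = 0 -> x = 0.
Proof.
by move=> h; apply/normr0_eq0/eqP; rewrite -sqrf_eq0 normE_inner h.
Qed.

Lemma bounded_opP T (M : R) :
  (forall (a : R[i]) x y, T (a *: x + y) = a *: T x + T y) ->
  (forall x, `|T x| <= M%:C%C * `|x|) -> bounded_op T.
Proof. by move=> lT bT; split=> [//|a x y _ _|]; [exact: lT|exists M => x _]. Qed.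

Lemma bounded_op_lin T (a : R[i]) x y :
  bounded_op T -> T (a *: x + y) = a *: T x + T y.
Proof. by move=> [_ + _]; exact. Qed.

Lemma bounded_op0 T : bounded_op T -> T 0 = 0.
Proof.
move=> bT; have := bounded_op_lin (-1) 0 0 bT.
by rewrite scaler0 addr0 scaleN1r addNr.
Qed.

Lemma bounded_opD T x y : bounded_op T -> T (x + y) = T x + T y.
Proof. by move=> bT; have := bounded_op_lin 1 x y bT; rewrite !scale1r. Qed.

Lemma bounded_opB T x y : bounded_op T -> T (x - y) = T x - T y.
Proof.
move=> bT; have := bounded_op_lin (-1) y x bT.
by rewrite !scaleN1r ![- _ + _]addrC.
Qed.

Lemma bounded_op_ge0 T : bounded_op T ->
  exists2 M : R, 0 <= M & forall x, `|T x| <= M%:C%C * `|x|.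
Proof.
move=> [_ _ [M bT]]; exists `|M| => // x; apply: (le_trans (bT x I)).
by rewrite ler_wpM2r// lecR ler_norm.
Qed.

Lemma bounded_op_id : bounded_op (@id V).
Proof. by apply: (@bounded_opP _ 1) => // x; rewrite mul1r. Qed.

Lemma bounded_op_comp (T T' : V -> V) : bounded_op T -> bounded_op T' ->
  bounded_op (T \o T').
Proof.
move=> bT bT'; have [M M0 TM] := bounded_op_ge0 bT.
have [N N0 TN] := bounded_op_ge0 bT'; apply: (@bounded_opP _ (M * N)).
  by move=> a x y /=; rewrite !bounded_op_lin.
move=> x; apply: (le_trans (TM _)).
by rewrite rmorphM/= -mulrA ler_wpM2l// ler0c.
Qed.

Lemma bounded_op_add (T T' : V -> V) : bounded_op T -> bounded_op T' ->
  bounded_op (fun x => T x + T' x).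
Proof.
move=> bT bT'; have [M M0 TM] := bounded_op_ge0 bT.
have [N N0 TN] := bounded_op_ge0 bT'; apply: (@bounded_opP _ (M + N)).
  move=> a x y; rewrite (bounded_op_lin _ _ _ bT).
  by rewrite (bounded_op_lin _ _ _ bT') scalerDr addrACA.
move=> x; rewrite rmorphD/= mulrDl.
by apply: (le_trans (ler_normD _ _)); exact: lerD.
Qed.

Lemma bounded_op_sub (T T' : V -> V) : bounded_op T -> bounded_op T' ->
  bounded_op (fun x => T x - T' x).
Proof.
move=> bT bT'; have [M M0 TM] := bounded_op_ge0 bT.
have [N N0 TN] := bounded_op_ge0 bT'; apply: (@bounded_opP _ (M + N)).
  move=> a x y; rewrite (bounded_op_lin _ _ _ bT).
  by rewrite (bounded_op_lin _ _ _ bT') scalerBr opprD addrACA.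
move=> x; rewrite rmorphD/= mulrDl.
by apply: (le_trans (ler_normB _ _)); exact: lerD.
Qed.

(** The inner product is nondegenerate, so an operator has one adjoint and the
    choice made by [adjoint] is forced. *)
Lemma adjoint_eq (T T' : V -> V) : is_adjoint T T' -> adjoint T = T'.
Proof.
move=> aT; rewrite /adjoint; apply: xget_unique => // T1 [_ T1P].
have [_ TP] := aT; apply/funext => y; apply/eqP; rewrite -subr_eq0; apply/eqP.
by apply: inner_eq0; rewrite linearBr/= -T1P -TP subrr.
Qed.

Lemma inner_conj x y : inner x y = Num.conj (inner y x).
Proof. by have := hermC (@inner R V) x y; rewrite expr0 mul1r. Qed.

Lemma is_adjoint_sym (T T' : V -> V) : bounded_op T -> is_adjoint T T' -> is_adjoint T' T.
Proof.
by move=> bT [_ aT]; split=> // x y; rewrite inner_conj -aT -inner_conj.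
Qed.

Lemma is_adjoint_comp (T T' U U' : V -> V) : is_adjoint T T' -> is_adjoint U U' ->
  is_adjoint (T \o U) (U' \o T').
Proof.
move=> [bT aT] [bU aU]; split; first exact: bounded_op_comp.
by move=> x y /=; rewrite aT aU.
Qed.

Lemma is_adjoint_add (T T' U U' : V -> V) : is_adjoint T T' -> is_adjoint U U' ->
  is_adjoint (fun x => T x + U x) (fun x => T' x + U' x).
Proof.
move=> [bT aT] [bU aU]; split; first exact: bounded_op_add.
by move=> x y; rewrite linearDl linearDr/= aT aU.
Qed.

(** Put y = D x, so that D y = 0.  Then <D (c y + x), c y + x> is
    conj(c) <y, y> + <y, x>, which cannot be nonnegative for every scalar c unless
    y = 0.  Self-adjointness of D is thereby avoided. *)
Lemma positive_sqr_eq0 D x : positive_op D -> D (D x) = 0 -> D x = 0.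
Proof.
move=> [bD pD]; set y := D x => Dy; apply/eqP; apply: contrapT => /negP y0.
have yy : 0 < inner y y by rewrite inner_norm exprn_gt0// normr_gt0.
have yx : 0 <= inner y x by exact: pD.
(* This c makes the quadratic form below equal to -1. *)
pose c := - ((inner y x + 1) / inner y y).
have cc : Num.conj c = c.
  apply: conj_Creal; rewrite realN ger0_real// divr_ge0 ?addr_ge0//; exact: ltW.
have := pD (c *: y + x); rewrite (bounded_op_lin _ _ _ bD) Dy scaler0 add0r.
rewrite linearDr/= linearZr_LR/= cc /c mulNr divfK ?gt_eqF//.
by rewrite opprD addrAC addNr add0r ler0N1.
Qed.

(** Let D be a positive square root of Q.  On the kernel of Q, D (D x) = 0 forces
    D x = 0.  On the range of Q, y = D x - x satisfies D y = - y, and positivity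
    forces y = 0.  Hence D and Q agree on both summands. *)
Lemma sqrt_op_projection Q : positive_op Q -> (forall x, Q (Q x) = Q x) ->
  sqrt_op Q = Q.
Proof.
move=> pQ QQ; rewrite /sqrt_op; apply: xget_unique => // D [pD DD].
have [bD _] := pD; have [bQ _] := pQ; apply/funext => x.
have DK : D (x - Q x) = 0.
  by apply: positive_sqr_eq0 => //; rewrite DD (bounded_opB _ _ bQ) QQ subrr.
have DR : D (Q x) = Q x.
  apply/eqP; rewrite -subr_eq0; apply/eqP; set y := _ - _.
  have Dy : D y = - y by rewrite /y (bounded_opB _ _ bD) DD QQ opprB.
  apply: inner_eq0; apply/eqP; rewrite eq_le inner_norm exprn_ge0// andbT.
  by have := pD.2 y; rewrite Dy linearNl/= inner_norm oppr_ge0.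
by rewrite -[in LHS](subrK (Q x) x) (bounded_opD _ _ bD) DK add0r DR.
Qed.

End HilbertGeneral.

(** * Forward and backward shifts of the coefficient matrix *)

Section Shifts.
Variable R : realType.
Local Notation C := R[i].
Implicit Types (f g h : hardy R) (u : nat -> nat -> R).

Definition shift_down (T : zmodType) (u : nat -> nat -> T) (i j : nat) : T :=
  if i is i'.+1 then u i' j else 0.

Lemma sqpart_trans u n : sqpart (fun i j => u j i) n = sqpart u n.
Proof. by rewrite /sqpart exchange_big. Qed.

Lemma sqpart_shift_down u n :
  sqpart (shift_down u) n.+1 = sqpart u n + \sum_(i < n) u i n.
Proof.
rewrite /sqpart big_ord_recl/= big1// add0r.
under eq_bigr => i _ do rewrite big_ord_recr/=.
by rewrite big_split.
Qed.

Lemma sqpart_shift_down_le u n : (forall i j, 0 <= u i j) ->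
  sqpart (shift_down u) n <= sqpart u n.
Proof.
move=> u0; case: n => [|n]; first by rewrite /sqpart !big_ord0.
rewrite /sqpart big_ord_recl/= big1// add0r [leRHS]big_ord_recr/=.
by rewrite lerDl sumr_ge0.
Qed.

(** Shifting trades the square partial sum for a slightly wider rectangle; the
    discrepancy is one column, dominated by the increment of the partial sums of
    the absolute values, which tends to 0 for a summable family. *)
Lemma abs_sqpart_shift_down u n :
  `|sqpart (shift_down u) n.+1 - sqpart u n| <=
  sqpart (fun i j => `|u i j|) n.+1 - sqpart (fun i j => `|u i j|) n.
Proof.
rewrite sqpart_shift_down addrC addKr; apply: le_trans (ler_norm_sum _ _ _) _.
have -> : sqpart (fun i j => `|u i j|) n.+1 = sqpart (fun i j => `|u i j|) n +
    \sum_(i < n) `|u i n| + \sum_(j < n.+1) `|u n j|.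
  rewrite /sqpart big_ord_recr/= -big_split/=; congr (_ + _).
  by apply: eq_bigr => i _; rewrite big_ord_recr.
by rewrite addrC !addrA addNr add0r lerDl sumr_ge0.
Qed.

Lemma lim_sqpart_shift_down u : bounded_sum (fun i j => `|u i j|) ->
  limn (sqpart (shift_down u)) = limn (sqpart u).
Proof.
move=> Bu; have cu := cvg_sqpart Bu.
have ca : cvgn (sqpart (fun i j => `|u i j|)).
  apply: cvg_sqpart; move: Bu; congr bounded_sum.
  by apply/funext => i; apply/funext => j; rewrite normr_id.
apply: cvg_lim => //; rewrite -cvg_shiftS.
have -> : (fun n => sqpart (shift_down u) n.+1) =
    (fun n => (sqpart (shift_down u) n.+1 - sqpart u n) + sqpart u n).
  by apply/funext => n; rewrite subrK.
rewrite -[limn (sqpart u)]add0r; apply: cvgD => //.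
apply: norm_cvg0.
apply: (@squeeze_cvgr _ _ _ _ (fun=> 0) (fun n => sqpart (fun i j => `|u i j|) n.+1
    - sqpart (fun i j => `|u i j|) n)).
- by near=> n; rewrite normr_ge0/= abs_sqpart_shift_down.
- exact: cvg_cst.
- rewrite -[X in _ --> X](subrr (limn (sqpart (fun i j => `|u i j|)))).
  by apply: cvgB => //; rewrite cvg_shiftS.
Unshelve. all: by end_near. Qed.

Lemma csum_shift_down (u : nat -> nat -> C) : abs_summable u ->
  csum (shift_down u) = csum u.
Proof.
move=> Bu; rewrite /csum; congr Complex.
  rewrite -(@lim_sqpart_shift_down (fun i j => complex.Re (u i j))); last first.
    by apply: le_bounded_sum Bu => i j; exact: normRe.
  by congr (limn (sqpart _)); apply/funext => -[|i]; apply/funext => j.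
rewrite -(@lim_sqpart_shift_down (fun i j => complex.Im (u i j))); last first.
  by apply: le_bounded_sum Bu => i j; exact: normIm.
by congr (limn (sqpart _)); apply/funext => -[|i]; apply/funext => j.
Qed.

Lemma csum_trans (u : nat -> nat -> C) : csum (fun i j => u j i) = csum u.
Proof.
by rewrite /csum; congr Complex; congr (lim (_ @ \oo)); apply/funext => n;
  rewrite -[RHS]sqpart_trans.
Qed.

Lemma bwd_subproof f : (fun i j => f i.+1 j) \in @hardy_pred R.
Proof.
rewrite unfold_in; apply/asboolP/square_summableE.
apply: (@bounded_sum_shiftl R (fun i j => nsq (f i j))).
  by move=> i j; exact: nsq_ge0.
exact/square_summableE/coef_sq.
Qed.

Lemma fwd_subproof f : shift_down f \in @hardy_pred R.
Proof.
rewrite unfold_in; apply/asboolP/square_summableE.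
have /square_summableE[M fM] := coef_sq f; exists M => n.
apply: le_trans (fM n); apply: le_trans (sqpart_shift_down_le _ _) => [|i j].
  rewrite le_eqVlt; apply/orP; left; apply/eqP; congr sqpart.
  by apply/funext => -[|i]; apply/funext => j //=; rewrite /nsq/= expr0n/= addr0.
exact: nsq_ge0.
Qed.

Lemma transp_subproof f : (fun i j => f j i) \in @hardy_pred R.
Proof.
rewrite unfold_in; apply/asboolP/square_summableE.
have /square_summableE[M fM] := coef_sq f; exists M => n.
by rewrite (sqpart_trans (fun i j => nsq (f i j))).
Qed.

Definition bwd1 f : hardy R := Hardy (bwd_subproof f).
Definition fwd1 f : hardy R := Hardy (fwd_subproof f).
Definition transp f : hardy R := Hardy (transp_subproof f).
(** The shifts in the second variable are conjugates of those in the first by the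
    unitary exchange of the variables, from which they inherit their properties. *)
Definition bwd2 f : hardy R := transp (bwd1 (transp f)).
Definition fwd2 f : hardy R := transp (fwd1 (transp f)).

Lemma hardy_coefD f g i j : (f + g) i j = f i j + g i j. Proof. by []. Qed.
Lemma hardy_coefB f g i j : (f - g) i j = f i j - g i j. Proof. by []. Qed.
Lemma hardy_coefZ (c : C) f i j : (c *: f) i j = c * (f i j : C). Proof. by []. Qed.

Lemma bwd1_lin (a : C) f g : bwd1 (a *: f + g) = a *: bwd1 f + bwd1 g.
Proof. exact: coef_inj. Qed.

Lemma fwd1_lin (a : C) f g : fwd1 (a *: f + g) = a *: fwd1 f + fwd1 g.
Proof.
by apply: coef_inj => -[|i] j; rewrite // hardy_coefD hardy_coefZ /= mulr0 addr0.
Qed.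

Lemma transp_lin (a : C) f g : transp (a *: f + g) = a *: transp f + transp g.
Proof. exact: coef_inj. Qed.

(** The product of the entries of [fwd1 f] and g is the shift of the product of
    the entries of f and [bwd1 g], and shifting does not change the sum. *)
Lemma fwd1_inner f g : inner (fwd1 f) g = inner f (bwd1 g).
Proof.
change (hardy_inner (fwd1 f) g = hardy_inner f (bwd1 g)).
rewrite /hardy_inner -[RHS]csum_shift_down; last first.
  exact: bounded_sumM (coef_sq _) (coef_sq _).
congr csum; apply/funext => -[|i]; apply/funext => j //=.
by rewrite mul0r.
Qed.

Lemma bwd1K : cancel fwd1 bwd1.
Proof. by move=> f; exact: coef_inj. Qed.

Lemma transp_inner f g : inner (transp f) g = inner f (transp g).
Proof.
change (hardy_inner (transp f) g = hardy_inner f (transp g)).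
by rewrite /hardy_inner -[LHS]csum_trans.
Qed.

Lemma transpK : involutive transp.
Proof. by move=> f; exact: coef_inj. Qed.

Lemma norm_isometry (T : hardy R -> hardy R) f :
  inner (T f) (T f) = inner f f -> `|T f| = `|f|.
Proof.
by rewrite !inner_norm => /eqP; rewrite eqrXn2// => /eqP.
Qed.

Lemma bounded_fwd1 : bounded_op fwd1.
Proof.
apply: (@bounded_opP _ _ _ 1); first exact: fwd1_lin.
by move=> f; rewrite mul1r norm_isometry// fwd1_inner bwd1K.
Qed.

Lemma bounded_transp : bounded_op transp.
Proof.
apply: (@bounded_opP _ _ _ 1); first exact: transp_lin.
by move=> f; rewrite mul1r norm_isometry// transp_inner transpK.
Qed.

(** The adjoint of an isometry is a contraction: by Cauchy-Schwarz,
    |bwd1 f|^2 = <fwd1 (bwd1 f), f> is at most |bwd1 f| |f|. *)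
Lemma bounded_bwd1 : bounded_op bwd1.
Proof.
apply: (@bounded_opP _ _ _ 1); first exact: bwd1_lin.
move=> f; rewrite mul1r.
have := dot_CauchySchwarz (@inner _ _) (fwd1 (bwd1 f)) f.
rewrite fwd1_inner !inner_norm (@norm_isometry fwd1); last by rewrite fwd1_inner bwd1K.
rewrite normrX normr_id => le2.
have [->|b0] := eqVneq (bwd1 f) 0; first by rewrite normr0.
have : `|bwd1 f| ^+ 2 <= `|f| ^+ 2.
  by rewrite -(@ler_pM2l _ (`|bwd1 f| ^+ 2))// ?exprn_gt0 ?normr_gt0// -expr2.
by rewrite ler_sqr ?nnegrE.
Qed.

Lemma adjoint_fwd1 : is_adjoint fwd1 bwd1.
Proof. by split; [exact: bounded_bwd1|exact: fwd1_inner]. Qed.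

Lemma adjoint_transp : is_adjoint transp transp.
Proof. by split; [exact: bounded_transp|exact: transp_inner]. Qed.

Lemma adjoint_fwd2 : is_adjoint fwd2 bwd2.
Proof.
exact: is_adjoint_comp adjoint_transp (is_adjoint_comp adjoint_fwd1 adjoint_transp).
Qed.

Lemma bounded_fwd2 : bounded_op fwd2.
Proof.
exact: bounded_op_comp bounded_transp (bounded_op_comp bounded_fwd1 bounded_transp).
Qed.

End Shifts.

(** * Evaluation functionals and multiplication operators *)

Section Multiplication.
Variable R : realType.
Local Notation C := R[i].
Implicit Types (f g h k : hardy R) (z w : C).

Lemma nsq_norm z : (nsq z)%:C%C = `|z| ^+ 2.
Proof. by rewrite -nsqE rmorphXn. Qed.

Lemma nsqM z w : nsq (z * w) = nsq z * nsq w.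
Proof. by rewrite -!nsqE Normc.normcM exprMn. Qed.

Lemma nsqX z n : nsq (z ^+ n) = nsq z ^+ n.
Proof.
elim: n => [|n IH]; last by rewrite !exprS nsqM IH.
by rewrite !expr0 /nsq/= expr1n expr0n addr0.
Qed.

Lemma nsq_conj z : nsq (Num.conj z) = nsq z.
Proof. by case: z => a b; rewrite /nsq/= sqrrN. Qed.

Lemma sum_geom_le (a : R) n : 0 <= a < 1 -> \sum_(i < n) a ^+ i <= (1 - a)^-1.
Proof.
move=> /andP[a0 a1]; have b0 : 0 < 1 - a by rewrite subr_gt0.
rewrite -(ler_pM2l b0) divff ?gt_eqF//.
have := subrX1 a n; rewrite -[1 - a]opprB mulNr => <-.
by rewrite opprB gerBl exprn_ge0.
Qed.

Lemma szego_sqpart z w n : nsq z < 1 -> nsq w < 1 ->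
  sqpart (fun i j => nsq (Num.conj z ^+ i * Num.conj w ^+ j)) n <=
  (1 - nsq z)^-1 * (1 - nsq w)^-1.
Proof.
move=> z1 w1; rewrite /sqpart.
under eq_bigr => i _ do under eq_bigr => j _ do rewrite nsqM !nsqX !nsq_conj.
under eq_bigr => i _ do rewrite -mulr_sumr.
rewrite -mulr_suml; apply: ler_pM; rewrite ?sumr_ge0//.
- by move=> i _; rewrite exprn_ge0// nsq_ge0.
- by move=> i _; rewrite exprn_ge0// nsq_ge0.
- by apply: sum_geom_le; rewrite nsq_ge0.
- by apply: sum_geom_le; rewrite nsq_ge0.
Qed.

Definition is_szego z w k := forall i j, k i j = Num.conj z ^+ i * Num.conj w ^+ j.

Lemma nsq_lt1 z : `|z| < 1 -> nsq z < 1.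
Proof. by move=> z1; rewrite -ltcR nsq_norm expr_lt1. Qed.

Lemma szego_exists z w : `|z| < 1 -> `|w| < 1 -> exists k, is_szego z w k.
Proof.
move=> /nsq_lt1 z1 /nsq_lt1 w1.
have kP : (fun i j => Num.conj z ^+ i * Num.conj w ^+ j : C^o) \in @hardy_pred R.
  rewrite unfold_in; apply/asboolP/square_summableE.
  by exists ((1 - nsq z)^-1 * (1 - nsq w)^-1) => n; exact: szego_sqpart.
by exists (Hardy kP).
Qed.

(** Turns evaluation into a bounded functional, so that its linearity and its
    behaviour under shifts follow from those of the inner product. *)
Lemma hardy_eval_inner z w k f : is_szego z w k -> hardy_eval f z w = inner f k.
Proof.
move=> kP; change (hardy_eval f z w = hardy_inner f k).
congr csum; apply/funext => i; apply/funext => j.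
by rewrite kP rmorphM !rmorphXn/= !conjCK mulrA.
Qed.

(** The squared norm is the product of two geometric series of ratio at most 1/4,
    hence at most 16/9; the uniformity in (z, w) is what later allows z to tend
    to 0. *)
Lemma szego_norm z w k : `|z| <= 2^-1 -> `|w| <= 2^-1 -> is_szego z w k ->
  `|k| <= 2.
Proof.
have nsq4 x : `|x| <= 2^-1 :> C -> nsq x <= 4^-1 :> R.
  move=> x2; rewrite -lecR nsq_norm fmorphV/= rmorph_nat.
  rewrite (_ : 4%:R^-1 = 2^-1 ^+ 2 :> C); last by rewrite exprVn -natrX.
  by rewrite lerXn2r// nnegrE// invr_ge0 ler0n.
move=> /nsq4 z4 /nsq4 w4 kP.
have -> : 2 = (2 : R)%:C%C by rewrite rmorph_nat.
apply/hardy_norm_le => // n.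
have -> : (fun i j => nsq (k i j)) =
    (fun i j => nsq (Num.conj z ^+ i * Num.conj w ^+ j)).
  by apply/funext => i; apply/funext => j; rewrite kP.
have le2 x : nsq x <= 4^-1 :> R -> (1 - nsq x)^-1 <= 2 :> R.
  move=> x4; rewrite invf_ple ?posrE//; last by lra.
  by lra.
apply: le_trans (szego_sqpart _ _ _) _; [lra|lra|].
rewrite expr2; apply: ler_pM; rewrite ?le2// invr_ge0; lra.
Qed.

Lemma hardy_eval_bound f z w : `|z| <= 2^-1 -> `|w| <= 2^-1 ->
  `|hardy_eval f z w| <= 2 * `|f|.
Proof.
move=> z2 w2; have lt1 : 2^-1 < 1 :> C by rewrite invf_lt1// ltr1n.
have [k kP] := szego_exists (le_lt_trans z2 lt1) (le_lt_trans w2 lt1).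
rewrite (hardy_eval_inner f kP) -ler_sqr ?nnegrE ?mulr_ge0//.
apply: le_trans (dot_CauchySchwarz _ _ _) _; rewrite !inner_norm -exprMn.
by rewrite ler_sqr ?nnegrE ?mulr_ge0// mulrC ler_wpM2r// (szego_norm z2 w2 kP).
Qed.

Section Points.
Variables (z w : C) (z1 : `|z| < 1) (w1 : `|w| < 1).

Lemma hardy_evalD f g : hardy_eval (f + g) z w = hardy_eval f z w + hardy_eval g z w.
Proof.
have [k kP] := szego_exists z1 w1.
by rewrite !(hardy_eval_inner _ kP) linearDl.
Qed.

Lemma hardy_evalB f g : hardy_eval (f - g) z w = hardy_eval f z w - hardy_eval g z w.
Proof.
have [k kP] := szego_exists z1 w1.
by rewrite !(hardy_eval_inner _ kP) linearBl.
Qed.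

Lemma hardy_eval_transp f : hardy_eval (transp f) w z = hardy_eval f z w.
Proof.
rewrite /hardy_eval -[LHS]csum_trans; congr csum.
by apply/funext => i; apply/funext => j; rewrite /= mulrAC.
Qed.

(** The kernel is an eigenvector of [bwd1] with eigenvalue conj(z). *)
Lemma hardy_eval_fwd1 f : hardy_eval (fwd1 f) z w = z * hardy_eval f z w.
Proof.
have [k kP] := szego_exists z1 w1.
rewrite !(hardy_eval_inner _ kP) fwd1_inner.
have -> : bwd1 k = Num.conj z *: k.
  by apply: coef_inj => i j; rewrite hardy_coefZ /= !kP exprS mulrA.
by rewrite linearZr_LR/= conjCK.
Qed.
End Points.

Lemma hardy_eval_fwd2 f z w : `|z| < 1 -> `|w| < 1 ->
  hardy_eval (fwd2 f) z w = w * hardy_eval f z w.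
Proof.
by move=> z1 w1; rewrite hardy_eval_transp hardy_eval_fwd1// hardy_eval_transp.
Qed.

(** The coordinate axes are left out of the domain so that the property passes to
    [bwd1 f], where a factor z has to be cancelled. *)
Definition vanishes f := forall z w,
  0 < `|z| <= 2^-1 -> 0 < `|w| <= 2^-1 -> hardy_eval f z w = 0.

Definition row0 f := f - fwd1 (bwd1 f).

Lemma row0E f i j : row0 f i j = if i == 0%N then f 0%N j else 0.
Proof. by case: i => [|i]; rewrite hardy_coefB /= ?subr0 ?subrr. Qed.

Lemma half_lt1 z : 0 < `|z| <= 2^-1 -> `|z| < 1.
Proof.
by move=> /andP[_ z2]; apply: (le_lt_trans z2); rewrite invf_lt1// ltr1n.
Qed.

Lemma hardy_eval_row0 f z z' w : hardy_eval (row0 f) z w = hardy_eval (row0 f) z' w.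
Proof.
congr csum; apply/funext => -[|i]; apply/funext => j; first by rewrite !expr0.
by rewrite !row0E !mul0r.
Qed.

Lemma small_eq0 (x c : C) : 0 <= c ->
  (forall t, 0 < t <= 2^-1 -> `|x| <= t * c) -> x = 0.
Proof.
move=> c0 xc; apply/eqP; apply: contrapT => /negP x0.
have x_gt0 : 0 < `|x| by rewrite normr_gt0.
have xc0 : 0 < `|x| + c by rewrite ltr_wpDr.
have /xc : 0 < 2^-1 * (`|x| / (`|x| + c)) <= 2^-1.
  rewrite mulr_gt0 ?divr_gt0// ?invr_gt0//=.
  by rewrite ler_piMr ?invr_ge0// ler_pdivrMr// mul1r lerDl.
move=> le1; suff : `|x| < `|x| by rewrite ltxx.
apply: (le_lt_trans le1); rewrite -mulrA; apply: (@le_lt_trans _ _ (2^-1 * `|x|)).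
  rewrite ler_pM2l ?invr_gt0// mulrAC ler_pdivrMr// ler_wpM2l//.
  by rewrite lerDr.
by rewrite gtr_pMl// invf_lt1// ltr1n.
Qed.

(** From 0 = f(t, w) = (row0 f)(t, w) + t (bwd1 f)(t, w) and the uniform bound on
    evaluations, |(row0 f)(t, w)| = O(t); but the left-hand side does not depend on
    t. *)
Lemma vanishes_row0 f : vanishes f -> vanishes (row0 f).
Proof.
move=> vf z w z2 w2; apply: (@small_eq0 _ (2 * `|bwd1 f|)) => [|t /andP[t0 t2]].
  by rewrite mulr_ge0.
have tt : `|t| = t by rewrite gtr0_norm.
have tP : 0 < `|t| <= 2^-1 by rewrite tt t0.
have [t1 w1] := (half_lt1 tP, half_lt1 w2).
rewrite (hardy_eval_row0 f z t) hardy_evalB// vf// sub0r normrN hardy_eval_fwd1//.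
rewrite normrM tt ler_wpM2l ?(ltW t0)//.
by apply: hardy_eval_bound; [rewrite tt|case/andP: w2].
Qed.

Lemma vanishes_bwd1 f : vanishes f -> vanishes (bwd1 f).
Proof.
move=> vf z w z2 w2; have [z1 w1] := (half_lt1 z2, half_lt1 w2).
have := vanishes_row0 vf z2 w2.
rewrite hardy_evalB// vf// sub0r hardy_eval_fwd1// => /eqP.
rewrite oppr_eq0 mulf_eq0 => /orP[/eqP zE|/eqP //].
by move: z2; rewrite zE normr0 ltxx.
Qed.

Lemma vanishes_transp f : vanishes f -> vanishes (transp f).
Proof. by move=> vf z w z2 w2; rewrite hardy_eval_transp vf. Qed.

(** Taking row 0, then column 0, leaves the constant a_00, which still vanishes
    as a function. *)
Lemma vanishes_coef00 f : vanishes f -> f 0%N 0%N = 0.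
Proof.
move=> vf; pose g := row0 (transp (row0 f)).
have vg : vanishes g by apply/vanishes_row0/vanishes_transp/vanishes_row0.
have gE i j : g i j = if (i == 0%N) && (j == 0%N) then f 0%N 0%N else 0.
  rewrite row0E; case: i => [|i] //; rewrite -[transp _ _ _]/(row0 f j 0%N) row0E.
  by case: j.
have half : 0 < `|2^-1 : C| <= 2^-1 by rewrite ger0_norm ?invr_ge0// invr_gt0 ltr0n/=.
have [k kP] := szego_exists (half_lt1 half) (half_lt1 half).
have : g = 0.
  (* g is supported at (0, 0), where every kernel has coefficient 1, so the
     norm of g is computed by pairing with a multiple of the kernel. *)
  apply: inner_eq0; rewrite -(mulr0 (Num.conj (f 0%N 0%N : C))).
  rewrite -(vg _ _ half half) (hardy_eval_inner _ kP).
  have -> : Num.conj (f 0%N 0%N : C) * inner g k = inner g ((f 0%N 0%N : C) *: k).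
    by rewrite linearZr_LR.
  change (hardy_inner g g = hardy_inner g ((f 0%N 0%N : C) *: k)).
  congr csum; apply/funext => i; apply/funext => j.
  rewrite hardy_coefZ gE kP; case: i j => [|i] [|j] /=; rewrite ?mul0r//.
  by rewrite !expr0 !mulr1.
by move=> g0; have := gE 0%N 0%N; rewrite g0.
Qed.

(** [vanishes] is stable under both backward shifts, and these move any entry to
    the position (0, 0). *)
Lemma vanishes_eq0 f : vanishes f -> f = 0.
Proof.
move=> vf; apply: coef_inj => i j.
elim: i f vf => [|i IH] f vf; last exact: IH (vanishes_bwd1 vf).
elim: j f vf => [|j IH] f vf; first exact: vanishes_coef00.
exact: IH (vanishes_transp (vanishes_bwd1 (vanishes_transp vf))).
Qed.

Lemma mult_op_eq (phi : C -> C -> C) (T : hardy R -> hardy R) :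
  (forall f z w, `|z| < 1 -> `|w| < 1 ->
    hardy_eval (T f) z w = phi z w * hardy_eval f z w) -> mult_op phi = T.
Proof.
move=> TP; apply/funext => f; apply: xget_unique => [z w z1 w1|g gP].
  exact: TP.
apply/eqP; rewrite -subr_eq0; apply/eqP/vanishes_eq0 => z w /half_lt1 z1 /half_lt1 w1.
by rewrite hardy_evalB// gP// TP// subrr.
Qed.

Lemma mult_op_add : mult_op (fun z w : C => z + w) = fun f => fwd1 f + fwd2 f.
Proof.
apply: mult_op_eq => f z w z1 w1.
by rewrite hardy_evalD// hardy_eval_fwd1// hardy_eval_fwd2// mulrDl.
Qed.

Lemma mult_op_mul : mult_op (fun z w : C => z * w) = fun f => fwd1 (fwd2 f).
Proof.
apply: mult_op_eq => f z w z1 w1.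
by rewrite hardy_eval_fwd1// hardy_eval_fwd2// mulrA.
Qed.

End Multiplication.

(** * The defect operator and the fundamental equation *)

Section DefectIsometry.
Variables (R : realType) (V : hilbertType R) (T T' : V -> V).
Hypotheses (bT : bounded_op T) (aT : is_adjoint T T') (TK : cancel T T').

(** For an isometry T with adjoint T', I - T T' is an orthogonal projection, hence
    its own square root. *)
Lemma defect_op_coisometry : defect_op T' = fun x => x - T (T' x).
Proof.
have bT' : bounded_op T' by case: aT.
rewrite /defect_op (adjoint_eq (is_adjoint_sym bT aT)).
have QK x : T' (x - T (T' x)) = 0 by rewrite (bounded_opB _ _ bT') TK subrr.
apply: sqrt_op_projection => [|x]; last by rewrite QK (bounded_op0 bT) subr0.
split; first exact: bounded_op_sub (bounded_op_id _) (bounded_op_comp bT bT').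
move=> x; set q := x - _.
have -> : inner q x = inner q q + inner q (T (T' x)) by rewrite -linearDr subrK.
have [_ aTE] := is_adjoint_sym bT aT.
by rewrite -aTE QK linear0l addr0 inner_norm exprn_ge0.
Qed.

End DefectIsometry.

Section Defect.
Variable R : realType.
Local Notation C := R[i].
Implicit Types (f g : hardy R).

Definition sum_bwd f := bwd1 f + bwd2 f.
Definition prod_bwd f := bwd2 (bwd1 f).
(** Written as I - P P', with P' the adjoint of P, to match the defect operator; by
    [axes_projE] it erases the entries with both indices positive. *)
Definition axes_proj f := f - fwd1 (fwd2 (prod_bwd f)).

Lemma bounded_op_sum_fwd : bounded_op (fun f => fwd1 f + fwd2 f).
Proof. exact: bounded_op_add (@bounded_fwd1 R) (@bounded_fwd2 R). Qed.

Lemma bounded_op_prod_fwd : bounded_op (fun f => fwd1 (fwd2 f)).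
Proof. exact: bounded_op_comp (@bounded_fwd1 R) (@bounded_fwd2 R). Qed.

Lemma adjoint_sum_fwd : is_adjoint (fun f => fwd1 f + fwd2 f) sum_bwd.
Proof. exact: is_adjoint_add (@adjoint_fwd1 R) (@adjoint_fwd2 R). Qed.

Lemma adjoint_prod_fwd : is_adjoint (fun f => fwd1 (fwd2 f)) prod_bwd.
Proof. exact: is_adjoint_comp (@adjoint_fwd1 R) (@adjoint_fwd2 R). Qed.

Lemma defect_op_prod_bwd : defect_op prod_bwd = axes_proj.
Proof.
apply: (defect_op_coisometry bounded_op_prod_fwd adjoint_prod_fwd) => f.
exact: coef_inj.
Qed.

Lemma axes_projE f i j : axes_proj f i j = if (1 <= i)%N && (1 <= j)%N then 0 else f i j.
Proof.
by case: i j => [|i] [|j]; rewrite hardy_coefB /= ?subr0 ?subrr.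
Qed.

Lemma axes_proj_id f : (forall i j, (1 <= i)%N -> (1 <= j)%N -> f i j = 0) ->
  axes_proj f = f.
Proof. by move=> f0; apply: coef_inj => -[|i] [|j]; rewrite axes_projE//= f0. Qed.

Lemma bounded_axes_proj : bounded_op axes_proj.
Proof.
exact: bounded_op_sub (bounded_op_id _)
  (bounded_op_comp bounded_op_prod_fwd (proj1 adjoint_prod_fwd)).
Qed.

Lemma coef_le_norm f i j : `|f i j : C| <= `|f|.
Proof.
rewrite -ler_sqr ?nnegrE// -nsq_norm hardy_normE hardy_innerE lecR.
exact: nsq_le_lim.
Qed.

(** The range is closed because it is cut out by the vanishing of coefficients,
    which are continuous by [coef_le_norm]. *)
Lemma closure_axes_proj : closure (range axes_proj) =
  [set f : hardy R | forall i j, (1 <= i)%N -> (1 <= j)%N -> f i j = 0].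
Proof.
apply/seteqP; split=> f /=; last first.
  by move=> f0; apply: subset_closure; exists f => //; exact: axes_proj_id.
move=> fc i j i1 j1; apply: contrapT => /eqP fij.
have [_ [[g _ <-]]] := fc _ (nbhsx_ballx f `|f i j : C| (ltac:(by rewrite normr_gt0))).
rewrite -ball_normE /ball_/= => lt; have := coef_le_norm (f - axes_proj g) i j.
rewrite hardy_coefB axes_projE i1 j1 subr0 => le.
by have := le_lt_trans le lt; rewrite ltxx.
Qed.

Lemma defect_space_prod_bwd : defect_space prod_bwd =
  [set f : hardy R | forall i j, (1 <= i)%N -> (1 <= j)%N -> f i j = 0].
Proof. by rewrite /defect_space defect_op_prod_bwd closure_axes_proj. Qed.

Lemma sum_bwdE f i j : sum_bwd f i j = f i.+1 j + f i j.+1. Proof. by []. Qed.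

(** On the defect space B is the compression of the adjoint of S, which makes it
    linear and bounded. *)
Lemma B_op_axes_proj f : (forall i j, (1 <= i)%N -> (1 <= j)%N -> f i j = 0) ->
  B_op f = axes_proj (sum_bwd f).
Proof.
move=> f0; apply: coef_inj => -[|i] [|j]; rewrite axes_projE// sum_bwdE /=.
  by rewrite (f0 1%N j.+1)// add0r.
by rewrite (f0 i.+1 1%N)// addr0.
Qed.

Lemma bounded_B_op : bounded_op_on (defect_space prod_bwd) (@B_op R).
Proof.
rewrite defect_space_prod_bwd.
have bQ : bounded_op (axes_proj \o sum_bwd).
  exact: bounded_op_comp bounded_axes_proj (proj1 adjoint_sum_fwd).
split.
- by move=> f _ [|i] [|j].
- move=> a f g f0 g0; rewrite !B_op_axes_proj//; first exact: (bounded_op_lin _ _ _ bQ).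
  by move=> i j i1 j1; rewrite hardy_coefD hardy_coefZ f0// g0// mulr0 addr0.
- have [_ _ [M bM]] := bQ; exists M => f f0; rewrite B_op_axes_proj//; exact: bM.
Qed.

Lemma fundamental_eq_coef f :
  sum_bwd f - (fwd1 (prod_bwd f) + fwd2 (prod_bwd f)) = axes_proj (B_op (axes_proj f)).
Proof.
apply: coef_inj => i j; rewrite axes_projE hardy_coefB sum_bwdE hardy_coefD.
have := axes_projE f; move: (axes_proj f) => g gE.
case: i j => [|i] [|j] /=; rewrite ?gE /= ?addr0 ?add0r ?subr0//.
- by rewrite addrAC subrr add0r.
- by rewrite addrK.
- by rewrite [X in _ - X]addrC subrr.
Qed.

End Defect.

(** * Von Neumann's inequality for the backward shifts *)

(** X^n - 1 splits and is separable, so it has n distinct roots. *)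
Lemma prim_root_exists (F : closedFieldType) n : (n > 0)%N -> n%:R != 0 :> F ->
  exists z : F, n.-primitive_root z.
Proof.
pose p : {poly F} := 'X^n - 1; have [r Dp] := closed_field_poly_normal p.
move=> n_gt0 n0; rewrite (monicP _) ?monicXnsubC // scale1r in Dp.
have rn1 : all n.-unity_root r by apply/allP=> z; rewrite -root_prod_XsubC -Dp.
have sz_r : (n < (size r).+1)%N.
  by rewrite -(size_prod_XsubC r id) -Dp size_XnsubC.
have [|z] := hasP (has_prim_root n_gt0 rn1 _ sz_r); last by exists z.
by rewrite -separable_prod_XsubC -Dp separable_Xn_sub_1.
Qed.

Section Fourier.
Variables (C : numClosedFieldType) (N : nat).
Hypothesis N0 : (0 < N)%N.

Lemma norm_unity_root (z : C) : z ^+ N = 1 -> `|z| = 1.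
Proof.
move=> zN; have : `|z| ^+ N = 1 by rewrite -normrX zN normr1.
by move/eqP; rewrite pexprn_eq1// -[N]prednK// => /eqP.
Qed.

Lemma sum_pow_unity_root (x : C) : x ^+ N = 1 ->
  \sum_(k < N) x ^+ k = N%:R *+ (x == 1).
Proof.
move=> xN; have [->|x1] := eqVneq x 1.
  by under eq_bigr do rewrite expr1n; rewrite sumr_const card_ord.
have := subrX1 x N; rewrite xN subrr => /esym/eqP.
by rewrite mulf_eq0 subr_eq0 (negbTE x1) => /eqP.
Qed.

Variable w : C.
Hypothesis wP : N.-primitive_root w.

(** Expanding the squares leaves, for each pair (i, j), the sum over k of
    (w^i conj(w)^j)^k, which is N if i = j and 0 otherwise. *)
Lemma parseval (b : nat -> C) :
  \sum_(k < N) `|\sum_(i < N) b i * (w ^+ k) ^+ i| ^+ 2 =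
  N%:R * \sum_(i < N) `|b i| ^+ 2.
Proof.
have wN : w ^+ N = 1 by exact: prim_expr_order.
have wc : w * Num.conj w = 1 by rewrite -normCK norm_unity_root// expr1n.
transitivity (\sum_(i < N) \sum_(j < N) b i * Num.conj (b j) *
    (\sum_(k < N) (w ^+ i * Num.conj w ^+ j) ^+ k)).
  transitivity (\sum_(k < N) \sum_(i < N) \sum_(j < N)
      (b i * (w ^+ k) ^+ i) * Num.conj (b j * (w ^+ k) ^+ j)).
    apply: eq_bigr => k _; rewrite normCK rmorph_sum/= mulr_suml.
    by apply: eq_bigr => i _; rewrite mulr_sumr.
  rewrite exchange_big; apply: eq_bigr => i _ /=.
  rewrite exchange_big; apply: eq_bigr => j _ /=.
  rewrite mulr_sumr; apply: eq_bigr => k _.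
  rewrite rmorphM !rmorphXn/= mulrACA exprMn -!exprM.
  by rewrite ![(k * _)%N]mulnC.
rewrite mulr_sumr; apply: eq_bigr => i _.
have xE (j : 'I_N) : (w ^+ i * Num.conj w ^+ j == 1) = (j == i).
  have cj : Num.conj w ^+ j * w ^+ j = 1 by rewrite -exprMn mulrC wc expr1n.
  rewrite -(inj_eq (mulIf (_ : w ^+ j != 0))); last first.
    by rewrite expf_neq0// -normr_eq0 norm_unity_root ?oner_eq0.
  rewrite -mulrA cj mulr1 mul1r (eq_prim_root_expr wP) !modn_small//.
  by rewrite eq_sym.
have xN (j : 'I_N) : (w ^+ i * Num.conj w ^+ j) ^+ N = 1.
  rewrite exprMn -!exprM ![(_ * N)%N]mulnC !exprM -rmorphXn/= wN rmorph1.
  by rewrite !expr1n mulr1.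
rewrite (bigD1 i)//= [X in _ + X]big1 ?addr0 => [|j ji].
  by rewrite sum_pow_unity_root// xE eqxx mulr1n -normCK mulrC.
by rewrite sum_pow_unity_root// xE (negbTE ji) mulr0n mulr0.
Qed.

Definition fourier2 (u v : C) (a : nat -> nat -> C) :=
  \sum_(j < N) (\sum_(i < N) a i j * u ^+ i) * v ^+ j.

Lemma parseval2 (a : nat -> nat -> C) :
  \sum_(k < N) \sum_(l < N) `|fourier2 (w ^+ k) (w ^+ l) a| ^+ 2 =
  N%:R ^+ 2 * \sum_(i < N) \sum_(j < N) `|a i j| ^+ 2.
Proof.
under eq_bigr => k _ do rewrite (parseval (fun j => \sum_(i < N) a i j * (w ^+ k) ^+ i)).
rewrite -mulr_sumr expr2 -mulrA; congr (_ * _).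
rewrite exchange_big/=; under eq_bigr => j _ do rewrite (parseval (a ^~ j)).
by rewrite -mulr_sumr exchange_big.
Qed.

Definition periodic (a : nat -> nat -> C) :=
  (forall i j, a (i + N)%N j = a i j) /\ (forall i j, a i (j + N)%N = a i j).

(** The shifted sum differs from the original by its two end terms, which agree
    by periodicity. *)
Lemma sum_periodic_shift (b : nat -> C) (u : C) : b N = b 0%N -> u ^+ N = 1 ->
  u * (\sum_(i < N) b i.+1 * u ^+ i) = \sum_(i < N) b i * u ^+ i.
Proof.
move=> bN uN; rewrite mulr_sumr.
under eq_bigr => i _ do rewrite mulrCA -exprS.
apply: (@addrI _ (b 0%N * u ^+ 0)).
rewrite -(big_ord_recl N (fun i : 'I_N.+1 => b i * u ^+ i)) big_ord_recr/=.
by rewrite uN bN expr0 addrC.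
Qed.

End Fourier.

Section VonNeumann.
Variable R : realType.
Local Notation C := R[i].
Implicit Types (a b : nat -> nat -> C) (F : {poly {poly C}}).

(** The formulas of the adjoints of S and P on coefficient matrices, without
    summability, since a nonzero periodic matrix is not square summable. *)
Definition sum_shift a i j := a i.+1 j + a i j.+1.
Definition prod_shift a i j := a i.+1 j.+1.

Definition poly2_shift F a i j := \sum_(k < size F) \sum_(l < size F`_k)
  F`_k`_l * iter l sum_shift (iter k prod_shift a) i j.

Section Periodic.
Variables (N : nat) (N0 : (0 < N)%N).

Lemma periodic_sum_shift a : periodic N a -> periodic N (sum_shift a).
Proof. by move=> [a1 a2]; split=> i j; rewrite /sum_shift -addSn ?a1 ?a2. Qed.

Lemma periodic_prod_shift a : periodic N a -> periodic N (prod_shift a).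
Proof. by move=> [a1 a2]; split=> i j; rewrite /prod_shift -addSn ?a1 ?a2. Qed.

(* The Fourier characters are taken at the inverses of s and t so that the
   eigenvalues of the backward shifts come out as s and t. *)
Variables (s t : C) (sN : s ^+ N = 1) (tN : t ^+ N = 1).
Let hat := fourier2 N s^-1 t^-1.

Let fourier2_shift1 a : periodic N a -> hat (fun i j => a i.+1 j) = s * hat a.
Proof.
move=> [a1 _]; rewrite /hat /fourier2 mulr_sumr; apply: eq_bigr => j _.
rewrite mulrA; congr (_ * _).
rewrite -(@sum_periodic_shift _ _ (a ^~ j) s^-1) ?exprVn ?sN ?invr1//.
  by rewrite mulVKf// -normr_eq0 (norm_unity_root N0 sN) oner_eq0.
exact: (a1 0%N).
Qed.

Let fourier2_shift2 a : periodic N a -> hat (fun i j => a i j.+1) = t * hat a.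
Proof.
move=> [_ a2]; rewrite /hat /fourier2.
rewrite -(@sum_periodic_shift _ _ (fun j => \sum_(i < N) a i j * s^-1 ^+ i) t^-1)
  ?exprVn ?tN ?invr1//.
  by rewrite mulVKf// -normr_eq0 (norm_unity_root N0 tN) oner_eq0.
by apply: eq_bigr => i _; rewrite (a2 _ 0%N : a i N = _).
Qed.

Lemma fourier2D a b : hat (fun i j => a i j + b i j) = hat a + hat b.
Proof.
rewrite /hat /fourier2 -big_split/=; apply: eq_bigr => j _.
by rewrite -mulrDl -big_split/=; under eq_bigr do rewrite mulrDl.
Qed.

Lemma fourier2Z (c : C) a : hat (fun i j => c * a i j) = c * hat a.
Proof.
rewrite /hat /fourier2 mulr_sumr; apply: eq_bigr => j _; rewrite mulrA mulr_sumr.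
by under eq_bigr do rewrite -mulrA.
Qed.

Lemma fourier2_sum n (a : 'I_n -> nat -> nat -> C) :
  hat (fun i j => \sum_(k < n) a k i j) = \sum_(k < n) hat (a k).
Proof.
rewrite /hat /fourier2 exchange_big/=; apply: eq_bigr => j _.
rewrite -mulr_suml exchange_big/=; congr (_ * _).
by apply: eq_bigr => i _; rewrite mulr_suml.
Qed.

Lemma fourier2_sum_shift a : periodic N a -> hat (sum_shift a) = (s + t) * hat a.
Proof. by move=> pa; rewrite fourier2D fourier2_shift1// fourier2_shift2// mulrDl. Qed.

Lemma fourier2_prod_shift a : periodic N a -> hat (prod_shift a) = s * t * hat a.
Proof.
move=> pa; rewrite -mulrA -fourier2_shift2// -fourier2_shift1//.
by case: pa => a1 a2; split=> i j; rewrite ?a1 -?addSn ?a2.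
Qed.

Lemma periodic_iter k l a : periodic N a ->
  periodic N (iter l sum_shift (iter k prod_shift a)).
Proof.
move=> pa; elim: l => [|l IH] /=; last exact: periodic_sum_shift.
by elim: k => [|k IH] //=; exact: periodic_prod_shift.
Qed.

Lemma fourier2_iter k l a : periodic N a ->
  hat (iter l sum_shift (iter k prod_shift a)) = (s + t) ^+ l * (s * t) ^+ k * hat a.
Proof.
move=> pa; elim: l => [|l IH] /=.
  rewrite mul1r; elim: k => [|k IH] /=; first by rewrite mul1r.
  by rewrite fourier2_prod_shift ?IH ?exprS ?mulrA//; exact: (periodic_iter k 0).
by rewrite fourier2_sum_shift ?IH ?exprS ?mulrA//; exact: periodic_iter.
Qed.

(** The transform carries polynomials in the shifts to values of the polynomial,
    because each Fourier coefficient is an eigenfunctional of both shifts. *)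
Lemma fourier2_poly2_shift F a : periodic N a ->
  hat (poly2_shift F a) = poly2_eval F (s + t) (s * t) * hat a.
Proof.
move=> pa; rewrite /poly2_shift fourier2_sum.
have -> : poly2_eval F (s + t) (s * t) =
    \sum_(k < size F) \sum_(l < size F`_k) F`_k`_l * (s + t) ^+ l * (s * t) ^+ k.
  rewrite /poly2_eval [F.[_]]horner_coef horner_sum; apply: eq_bigr => k _.
  rewrite hornerM -polyC_exp hornerC horner_coef mulr_suml.
  by [].
rewrite mulr_suml; apply: eq_bigr => k _.
rewrite fourier2_sum mulr_suml; apply: eq_bigr => l _.
by rewrite fourier2Z fourier2_iter// !mulrA.
Qed.

End Periodic.

Definition poly2_bounded F (r : R) :=
  forall z, Gamma z -> `|poly2_eval F z.1 z.2| <= r%:C%C.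

(** By Parseval the claim can be checked on Fourier coefficients, where the
    operator multiplies by values of F on Gamma. *)
Lemma poly2_shift_periodic F r N a : poly2_bounded F r -> (0 < N)%N -> periodic N a ->
  \sum_(i < N) \sum_(j < N) `|poly2_shift F a i j| ^+ 2 <=
  r%:C%C ^+ 2 * \sum_(i < N) \sum_(j < N) `|a i j| ^+ 2.
Proof.
move=> Fr N0 pa; have NC0 : N%:R != 0 :> C by rewrite pnatr_eq0 -lt0n.
have [w wP] := prim_root_exists N0 NC0.
have wN : w ^+ N = 1 by exact: prim_expr_order.
have NC2 : 0 < N%:R ^+ 2 :> C by rewrite exprn_gt0// ltr0n.
rewrite -(ler_pM2l NC2) mulrCA -!(parseval2 N0 wP) mulr_sumr.
apply: ler_sum => k _; rewrite mulr_sumr; apply: ler_sum => l _.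
have kN (m : nat) : (w ^+ m)^-1 ^+ N = 1 by rewrite exprVn exprAC wN expr1n invr1.
rewrite -[X in fourier2 _ X]invrK -[X in fourier2 _ _ X]invrK.
rewrite fourier2_poly2_shift// normrM exprMn ler_wpM2r ?exprn_ge0//.
have n1 (m : nat) : `|(w ^+ m)^-1| <= 1 by rewrite (norm_unity_root N0 (kN m)).
have G : Gamma ((w ^+ k)^-1 + (w ^+ l)^-1, (w ^+ k)^-1 * (w ^+ l)^-1).
  by exists ((w ^+ k)^-1, (w ^+ l)^-1); split; exact: n1.
have := Fr _ G; rewrite /= => le.
by rewrite lerXn2r// nnegrE//; exact: le_trans le.
Qed.

Definition agree n a b := forall i j, (i < n)%N -> (j < n)%N -> a i j = b i j.

Lemma agree_sum_shift n a b : agree n.+1 a b -> agree n (sum_shift a) (sum_shift b).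
Proof. by move=> ab i j i_n j_n; rewrite /sum_shift !ab// ltnS ltnW. Qed.

Lemma agree_prod_shift n a b : agree n.+1 a b -> agree n (prod_shift a) (prod_shift b).
Proof. by move=> ab i j i_n j_n; rewrite /prod_shift ab. Qed.

Lemma agree_iter n k l a b : agree (n + l + k) a b ->
  agree n (iter l sum_shift (iter k prod_shift a))
          (iter l sum_shift (iter k prod_shift b)).
Proof.
elim: l n => [|l IH] n /=.
  rewrite addn0; elim: k n => [|k IH] n /=; first by rewrite addn0.
  by rewrite addnS -addSn => ab; apply/agree_prod_shift/IH.
by rewrite addnS -addSn => ab; apply/agree_sum_shift/IH.
Qed.

(** A crude bound on how far [poly2_shift F] looks beyond the entry it computes. *)
Definition poly2_size F := (size F + \max_(k < size F) size (F`_k)%R)%N.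

Lemma agree_poly2_shift F n a b : agree (n + poly2_size F) a b ->
  agree n (poly2_shift F a) (poly2_shift F b).
Proof.
move=> ab i j i_n j_n; apply: eq_bigr => k _; apply: eq_bigr => l _.
congr (_ * _); apply: (@agree_iter n) => // x y xn yn.
have le : (n + l + k <= n + poly2_size F)%N.
  rewrite -addnA leq_add2l addnC leq_add ?(ltnW (ltn_ord _))//.
  exact: leq_trans (ltnW (ltn_ord l)) (leq_bigmax k).
by apply: ab; [exact: leq_trans xn le|exact: leq_trans yn le].
Qed.

Lemma sqpart_norm a n : (sqpart (fun i j => nsq (a i j)) n)%:C%C =
  \sum_(i < n) \sum_(j < n) `|a i j| ^+ 2.
Proof.
rewrite /sqpart rmorph_sum; apply: eq_bigr => i _.
by rewrite rmorph_sum; apply: eq_bigr => j _; exact: nsq_norm.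
Qed.

(** Locality reduces the general case to the periodic one: the N-periodic extension
    of the N x N block of a has the same n x n block of the image. *)
Lemma poly2_shift_le F r n a : poly2_bounded F r ->
  exists m, sqpart (fun i j => nsq (poly2_shift F a i j)) n <=
    r ^+ 2 * sqpart (fun i j => nsq (a i j)) m.
Proof.
move=> Fr; pose N := (n + poly2_size F).+1; exists N.
pose a' i j := a (i %% N)%N (j %% N)%N.
have pa : periodic N a' by split=> i j; rewrite /a' modnDr.
have aa' : agree N a a' by move=> i j iN jN; rewrite /a' !modn_small.
have aF : agree n (poly2_shift F a) (poly2_shift F a').
  by apply: agree_poly2_shift => i j iN jN; apply: aa'; exact: ltnW.
have sE m u v : agree m u v ->
    sqpart (fun i j => nsq (u i j)) m = sqpart (fun i j => nsq (v i j)) m.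
  by move=> uv; apply: eq_bigr => i _; apply: eq_bigr => j _; rewrite uv.
rewrite (sE _ _ _ aF) (sE _ _ _ aa').
apply: (@le_trans _ _ (sqpart (fun i j => nsq (poly2_shift F a' i j)) N)).
  by apply: sqpart_le => [i j|]; [exact: nsq_ge0|rewrite /N; lia].
rewrite -lecR rmorphM rmorphXn/= !sqpart_norm.
exact: poly2_shift_periodic.
Qed.

Lemma coef_sum n (f : 'I_n -> hardy R) i j :
  (\sum_(k < n) f k) i j = \sum_(k < n) (f k i j : C).
Proof. exact: (big_morph (fun f : hardy R => f i j : C)). Qed.

Lemma poly2_op_coef F (f : hardy R) i j :
  poly2_op F (@sum_bwd R) (@prod_bwd R) f i j = poly2_shift F f i j.
Proof.
rewrite /poly2_op coef_sum; apply: eq_bigr => k _.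
rewrite coef_sum; apply: eq_bigr => l _; rewrite hardy_coefZ; congr (_ * _).
have pE m : coef (iter m (@prod_bwd R) f) = iter m prod_shift f.
  by elim: m => [//|m IH] /=; rewrite -IH.
have sE m g : coef (iter m (@sum_bwd R) g) = iter m sum_shift g.
  by elim: m => [//|m IH] /=; rewrite -IH.
by rewrite -pE -sE.
Qed.

Lemma norm_poly2_op F (f : hardy R) r : 0 <= r -> poly2_bounded F r -> `|f| <= 1 ->
  `|poly2_op F (@sum_bwd R) (@prod_bwd R) f| <= r%:C%C.
Proof.
move=> r0 Fr; rewrite -[X in _ <= X -> _](rmorph1 (real_complex R)) => f1.
apply/hardy_norm_le => // n.
have [m] := poly2_shift_le n f Fr.
under [X in sqpart X n <= r ^+ 2]eq_fun => i do
  under eq_fun => j do rewrite poly2_op_coef.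
move=> /le_trans; apply; rewrite -[leRHS]mulr1 ler_wpM2l ?exprn_ge0 ?sqr_ge0//.
by have /(hardy_norm_le _ ler01) := f1; rewrite expr1n; exact.
Qed.

(** The supremum on the right is nonnegative; if it is infinite there is nothing to
    prove, and otherwise it is a bound r to which [norm_poly2_op] applies. *)
Lemma gamma_contraction_bwd : gamma_contraction (@sum_bwd R) (@prod_bwd R).
Proof.
split.
- by case: (@adjoint_sum_fwd R).
- by case: (@adjoint_prod_fwd R).
- by move=> f; exact: coef_inj.
move=> F; set s := ereal_sup _.
have ub z : Gamma z -> ((complex.Re `|poly2_eval F z.1 z.2|)%:E <= s)%E.
  by move=> zG; apply: ereal_sup_ubound; exists z.
have ReE (z : C) : (complex.Re `|z|)%:C%C = `|z| by rewrite RRe_real// normr_real.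
have G0 : @Gamma R (0, 0).
  by exists (0, 0); rewrite /= ?normr0 ?addr0 ?mulr0 ?ler01.
have s0 : (0 <= s)%E.
  by apply: le_trans (ub _ G0); rewrite lee_fin -lecR ReE rmorph0.
apply: ge_ereal_sup => _ [f /= f1 <-].
case: s ub s0 => [r| |] ub s0 //; last by rewrite leey.
rewrite lee_fin -lecR RRe_real ?normr_real//.
apply: norm_poly2_op => // z zG.
by have := ub z zG; rewrite lee_fin -lecR ReE.
Qed.

End VonNeumann.

(** * The fundamental operator *)

Theorem lemma19 (R : realType) :
  let S := mult_op (fun z1 z2 : R[i] => z1 + z2) in
  let P := mult_op (fun z1 z2 : R[i] => z1 * z2) in
  defect_space (adjoint P) =
    [set f : hardy R | forall i j, (1 <= i)%N -> (1 <= j)%N -> f i j = 0] /\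
  is_fundamental_operator (adjoint S) (adjoint P) (@B_op R).
Proof.
move=> S P; have -> : adjoint P = @prod_bwd R.
  by rewrite /P mult_op_mul; exact/adjoint_eq/adjoint_prod_fwd.
have -> : adjoint S = @sum_bwd R.
  by rewrite /S mult_op_add; exact/adjoint_eq/adjoint_sum_fwd.
have SE : adjoint (@sum_bwd R) = fun f => fwd1 f + fwd2 f.
  exact: adjoint_eq (is_adjoint_sym (@bounded_op_sum_fwd R) (@adjoint_sum_fwd R)).
have BF : fundamental_equation (@sum_bwd R) (@prod_bwd R) (@B_op R).
  by move=> f; rewrite SE defect_op_prod_bwd; exact: fundamental_eq_coef.
split; first exact: defect_space_prod_bwd.
split=> // [||Y [Ycl _ _] YF f fD].
- exact: gamma_contraction_bwd.
- exact: bounded_B_op.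
have BD : defect_space (@prod_bwd R) (B_op f) by case: (@bounded_B_op R) => + _ _; exact.
(* Both sides of Y f = B f are fixed by the defect operator, as is f, so the two
   fundamental equations can be compared directly. *)
have := YF f; rewrite BF defect_op_prod_bwd.
have Yf := Ycl f fD; move: Yf BD fD; rewrite defect_space_prod_bwd => Yf Bf ff.
by rewrite (axes_proj_id ff) (axes_proj_id Yf) (axes_proj_id Bf).
Qed.
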